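(* For $i=1,2$ let $m_i,n_i\geq 1$ be integers and let $p_i\in\mathbb{C}[x,y]$ be a polynomial divisible neither by $x$ nor by $y$ and satisfying $\deg_x p_i<m_i$ and $\deg_y p_i<n_i$. Let $X_1=X(m_1,n_1,p_1)$ and $X_2=X(m_2,n_2,p_2)$. If $\deg p_1=m_1+n_1-2$ but $\deg p_2<m_2+n_2-2$, then $X_1$ and $X_2$ are not isomorphic as algebraic varieties.
   Context: Everything is over $\mathbb{C}$. $\mathbb{A}^2_*=\mathrm{Spec}(\mathbb{C}[x,y])\setminus\{(0,0)\}$. For integers $m,n\geq 1$ and a polynomial $p\in\mathbb{C}[x,y]$ divisible neither by $x$ nor by $y$ with $\deg_x p<m$ and $\deg_y p<n$, $X(m,n,p)$ denotes the variety $$X(m,n,p)=\{x^m v-y^n u=p(x,y)\}\setminus\{x=y=0\}\subset\mathbb{A}^2_*\times\mathrm{Spec}(\mathbb{C}[u,v]),$$ which is the total space of a Zariski locally trivial $\mathbb{A}^1$-bundle over $\mathbb{A}^2_*$ via the projection $(x,y,u,v)\mapsto(x,y)$. Here $\deg_x,\deg_y$ denote the degrees in $x$ and in $y$, and $\deg$ the total degree. *)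

(* Defs.v *)
From mathcomp Require Import all_boot all_order all_algebra.
From mathcomp Require Import boolp classical_sets reals.
From mathcomp Require Import complex mpoly.

Set Implicit Arguments.
Unset Strict Implicit.
Unset Printing Implicit Defensive.

Import GRing.Theory.
Local Open Scope classical_set_scope.
Local Open Scope ring_scope.

(* A variety is represented by its set of closed points, a locally closed      *)
(* subset of an affine space K^n, with its Zariski topology and its regular    *)
(* functions.  For reduced quasi-affine varieties over an algebraically closed *)
(* field, morphisms in this sense are the morphisms of varieties over K.       *)

Definition affine (K : fieldType) (n : nat) : Type := 'I_n -> K.

Definition zero_locus (K : fieldType) (n : nat) (S : set {mpoly K[n]}) :
    set (affine K n) :=
  [set a | forall q, S q -> q.@[a] = 0].

Definition zariski_open_in (K : fieldType) (n : nat)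
    (X U : set (affine K n)) : Prop :=
  exists S : set {mpoly K[n]}, U = X `&` ~` zero_locus S.

Definition regular_on (K : fieldType) (n : nat)
    (U : set (affine K n)) (f : affine K n -> K) : Prop :=
  forall a, U a ->
    exists (V : set (affine K n)) (g h : {mpoly K[n]}),
      [/\ zariski_open_in U V, V a &
          forall b, V b -> h.@[b] != 0 /\ f b = g.@[b] / h.@[b]].

(* Maps are total functions between the ambient affine spaces; only their      *)
(* restriction to the source X matters.                                        *)
Definition morphism (K : fieldType) (n k : nat)
    (X : set (affine K n)) (Y : set (affine K k))
    (phi : affine K n -> affine K k) : Prop :=
  [/\ forall a, X a -> Y (phi a),
      forall V, zariski_open_in Y V -> zariski_open_in X (X `&` phi @^-1` V) &
      forall V f, zariski_open_in Y V -> regular_on V f ->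
        regular_on (X `&` phi @^-1` V) (f \o phi)].

Definition isomorphic (K : fieldType) (n k : nat)
    (X : set (affine K n)) (Y : set (affine K k)) : Prop :=
  exists (phi : affine K n -> affine K k) (psi : affine K k -> affine K n),
    [/\ morphism X Y phi, morphism Y X psi,
        forall a, X a -> psi (phi a) = a &
        forall b, Y b -> phi (psi b) = b].

(* In K[x, y] = {mpoly K[2]}, x and y are the variables of index ord0 and      *)
(* ord_max.                                                                    *)

Definition divisible_by_var (K : fieldType) (n : nat) (i : 'I_n)
    (p : {mpoly K[n]}) : Prop :=
  exists q : {mpoly K[n]}, p = 'X_i * q.

(* Both degrees take the value 0 at p = 0.                                     *)
Definition deg_var (K : fieldType) (n : nat) (i : 'I_n)
    (p : {mpoly K[n]}) : nat :=
  \max_(m <- msupp p) m i.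

Definition deg (K : fieldType) (n : nat) (p : {mpoly K[n]}) : nat :=
  (msize p).-1.

(* Coordinates 0, 1, 2, 3 are x, y, u, v, in this order.                       *)
Definition X_variety (K : fieldType) (m n : nat) (p : {mpoly K[2]}) :
    set (affine K 4) :=
  [set a : affine K 4 |
     let x : K := a (0 : 'I_4) in let y : K := a (1 : 'I_4) in
     let u : K := a (2 : 'I_4) in let v : K := a (3 : 'I_4) in
     x ^+ m * v - y ^+ n * u = p.@[tnth [tuple x; y]] /\
     ~ (x = 0 /\ y = 0)].

(* Main.v *)
Require Import Defs.
From HB Require Import structures.
From mathcomp Require Import all_boot all_order all_algebra.
From mathcomp Require Import boolp classical_sets reals.
From mathcomp Require Import complex mpoly.
From mathcomp Require Import qpoly.
From mathcomp Require Import ring zify.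

Set Implicit Arguments.
Unset Strict Implicit.
Unset Printing Implicit Defensive.

Import Order.TTheory GRing.Theory Num.Theory.
Local Open Scope classical_set_scope.
Local Open Scope ring_scope.

(** Over x <> 0 the fibre coordinate of X(m, n, p) is T = u / x^m, and over
    y <> 0 it is v / y^n = T + g with g = p / (x^m y^n).  As the two coordinates
    differ by a translation, dx dy dT is a volume form w on the whole of
    X(m, n, p).  An isomorphism X_1 -> X_2 pulls w_2 back to an invertible
    regular function times w_1, and such functions are constants.  So it is an
    invariant of the variety whether w is exact, that is, whether some regular
    vector field has divergence 1 with respect to w.  This happens exactly when
    the Laurent polynomial g has no term in 1/(xy), a term whose coefficient is
    the one of x^(m-1) y^(n-1) in p.  By the bounds on deg_x p and deg_y p this
    is the only monomial of total degree m + n - 2 that p may contain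
    (top_coef_neq0, top_coef_eq0): it occurs in p_1 and not in p_2.

    If the term is absent, then g = dP/dx + dQ/dy for Laurent polynomials P and
    Q.  As p is not zero, every Laurent polynomial in x and y is a difference of
    regular functions on the two charts (splits_all): a multiple of g is
    1/(xy) up to such differences, which gives regular functions u and v with
    y u - x v = 1, and high powers of this relation split every pole.  Splitting
    P and Q corrects the field T d/dT of the charts into a global field of
    divergence 1 (divergence1_field).  Conversely, if a regular field has
    divergence 1, integration along the fibres between the zero sections of the
    two charts expresses g as a function without pole in y, plus one without
    pole in x, plus an x-derivative and a y-derivative; none of these has a
    term in 1/(xy) (divergence1_residue).

    To transport the field, it is seen as a derivation of the ring of regular
    functions.  Its divergence is determined by its action on the Jacobian
    bracket {f, h, k}, where df dh dk = {f, h, k} w (bracket_field), and an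
    isomorphism multiplies brackets by a constant (jacobian, reg_unit).  This
    proves the algebraic form of the theorem, residue_invariant.

    To pass from varieties to rings, regular functions are identified with
    polynomials in T over Laurent polynomials.  A function regular where one
    coordinate does not vanish is a polynomial divided by a power of that
    coordinate (regular_principal_open): on lines this follows from the theory
    of polynomials in one variable, and Lagrange interpolation in each variable
    in turn assembles the lines. *)

(** * Derivations of fraction fields *)

Definition derivation (R : comNzRingType) (d : R -> R) : Prop :=
  (forall a b, d (a + b) = d a + d b) /\
  (forall a b, d (a * b) = d a * b + a * d b).

Section Derivation.
Variables (R : comNzRingType) (d : R -> R).
Hypothesis der : derivation d.

Lemma derD a b : d (a + b) = d a + d b. Proof. by case: der. Qed.

Lemma derM a b : d (a * b) = d a * b + a * d b. Proof. by case: der. Qed.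

Lemma der0 : d 0 = 0.
Proof. by have /(congr1 (+%R (- d 0))) := derD 0 0; rewrite addr0 addrA addNr add0r. Qed.

Lemma derN a : d (- a) = - d a.
Proof. by apply/eqP; rewrite -addr_eq0 -derD addNr der0. Qed.

Lemma derB a b : d (a - b) = d a - d b.
Proof. by rewrite derD derN. Qed.

Lemma derMn a k : d (a *+ k) = d a *+ k.
Proof. by elim: k => [|k IH]; rewrite ?der0 // !mulrS derD IH. Qed.

Lemma der1 : d 1 = 0.
Proof.
have := derM 1 1; rewrite !mulr1 mul1r => /(congr1 (+%R (- d 1))).
by rewrite addNr addrA addNr add0r.
Qed.

Lemma derXn a k : d (a ^+ k.+1) = k.+1%:R * a ^+ k * d a.
Proof.
elim: k => [|k IH]; first by rewrite expr1 expr0 !mul1r.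
by rewrite exprS derM IH [k.+2%:R]mulrS [a ^+ k.+1]exprS; ring.
Qed.

Lemma der_sum (I : Type) (r : seq I) (P : pred I) (f : I -> R) :
  d (\sum_(i <- r | P i) f i) = \sum_(i <- r | P i) d (f i).
Proof. by apply: (big_morph d derD der0). Qed.

End Derivation.

Local Notation "x %:F" := (@FracField.tofrac _ x).

Section FractionDerivation.
Variables (R : idomainType).

Lemma frac_numden (w : {fraction R}) :
  w = (\n_(repr w))%:F / (\d_(repr w))%:F.
Proof.
apply: (canRL (mulfK _)); first by rewrite tofrac_eq0 denom_ratioP.
have piE (r : {ratio R}) : \pi_{fraction R}%qT r * (\d_r)%:F = (\n_r)%:F.
  unlock FracField.tofrac; rewrite -[LHS]FracField.pi_mul; apply/eqP.
  rewrite eqmodE /= FracField.equivfE.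
  rewrite /FracField.mulf !numden_Ratio ?mulr1 ?oner_eq0 ?denom_ratioP //.
  by rewrite mulrC.
by have := piE (repr w); rewrite reprK.
Qed.

Lemma fracP (w : {fraction R}) : exists n e, e != 0 /\ w = n%:F / e%:F.
Proof.
by exists \n_(repr w), \d_(repr w); split; [exact: denom_ratioP|exact: frac_numden].
Qed.

Definition frac_deriv (d : R -> R) (w : {fraction R}) : {fraction R} :=
  let: n := \n_(repr w) in let: e := \d_(repr w) in
  (d n * e - n * d e)%:F / (e ^+ 2)%:F.

Variable d : R -> R.
Hypothesis der : derivation d.

Lemma frac_derivE n e : e != 0 ->
  frac_deriv d (n%:F / e%:F) = (d n * e - n * d e)%:F / (e ^+ 2)%:F.
Proof.
move=> e0; have [n' [e' [e'0 /eqP E ->]]] :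
    exists n' e', [/\ e' != 0, n%:F / e%:F = n'%:F / e'%:F &
      frac_deriv d (n%:F / e%:F) = (d n' * e' - n' * d e')%:F / (e' ^+ 2)%:F].
  exists \n_(repr (n%:F / e%:F)), \d_(repr (n%:F / e%:F)); split=> //.
  - exact: denom_ratioP.
  - exact: frac_numden.
move: E; rewrite eqr_div ?tofrac_eq0 // -!tofracM tofrac_eq => /eqP E.
have E1 := congr1 d E; rewrite !(derM der) in E1.
apply/eqP; rewrite eqr_div ?tofrac_eq0 ?expf_neq0 // -!tofracM tofrac_eq.
rewrite -subr_eq0; apply/eqP.
transitivity ((e * e') * ((d n' * e + n' * d e) - (d n * e' + n * d e'))
 + (n * e' - n' * e) * (e * d e' + d e * e')); first by ring.
by rewrite -E1 E !subrr mulr0 mul0r addr0.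
Qed.

Lemma frac_deriv_derivation : derivation (frac_deriv d).
Proof.
split=> a b; have [na [ea [ea0 ->]]] := fracP a; have [nb [eb [eb0 ->]]] := fracP b.
  have -> : na%:F / ea%:F + nb%:F / eb%:F = (na * eb + nb * ea)%:F / (ea * eb)%:F.
    by rewrite addf_div ?tofrac_eq0 // -!tofracM -tofracD.
  rewrite !frac_derivE ?mulf_neq0 // !(derM der, derD der) addf_div ?tofrac_eq0 ?expf_neq0 //.
  by rewrite -!tofracM -tofracD; congr (_%:F / _%:F); ring.
have -> : na%:F / ea%:F * (nb%:F / eb%:F) = (na * nb)%:F / (ea * eb)%:F.
  by rewrite mulf_div -!tofracM.
rewrite !frac_derivE ?mulf_neq0 // !(derM der, derD der) !mulf_div -!tofracM.
rewrite addf_div ?tofrac_eq0 ?mulf_neq0 ?expf_neq0 // -!tofracM -tofracD.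
apply/eqP; rewrite eqr_div ?tofrac_eq0 ?mulf_neq0 ?expf_neq0 // -!tofracM tofrac_eq.
by apply/eqP; ring.
Qed.

Lemma frac_deriv_tofrac a : frac_deriv d a%:F = (d a)%:F.
Proof.
by rewrite -[a%:F]divr1 -tofrac1 frac_derivE ?oner_eq0 // expr1n tofrac1 divr1
  (der1 der) mulr0 subr0 mulr1.
Qed.
End FractionDerivation.

Lemma frac_deriv_comm (R : idomainType) (d d' : R -> R) :
  derivation d -> derivation d' -> (forall a, d (d' a) = d' (d a)) ->
  forall w, frac_deriv d (frac_deriv d' w) = frac_deriv d' (frac_deriv d w).
Proof.
move=> der der' com w; have [n [e [e0 ->]]] := fracP w.
rewrite !frac_derivE ?expf_neq0 //; congr (_%:F / _).
rewrite !expr2 !(derB der, derB der', derM der, derM der') !com; ring.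
Qed.

(** * Polynomials over a differential field *)

Section CoefDerivation.
Variables (F : comNzRingType) (d : F -> F).
Hypothesis der : derivation d.

Lemma coef_map_der (w : {poly F}) i : (map_poly d w)`_i = d w`_i.
Proof. exact: coef_map_id0 (der0 der). Qed.

Lemma map_derC c : map_poly d c%:P = (d c)%:P.
Proof. by apply/polyP=> i; rewrite coef_map_der !coefC; case: eqP => // _; exact: der0. Qed.

Lemma map_derX : map_poly d 'X = 0.
Proof.
by apply/polyP=> i; rewrite coef_map_der coefX coef0; case: eqP => _;
  rewrite ?(der1 der) ?(der0 der).
Qed.

Lemma map_der_derivation : derivation (map_poly d).
Proof.
split=> a b; apply/polyP=> i.
  by rewrite coefD !coef_map_der coefD (derD der).
rewrite coefD coef_map_der !coefM (der_sum der) -big_split /=.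
by apply: eq_bigr => j _; rewrite (derM der) !coef_map_der.
Qed.

Lemma map_der_deriv w : map_poly d w^`() = (map_poly d w)^`().
Proof.
by apply/polyP=> i; rewrite coef_map_der !coef_deriv coef_map_der (derMn der).
Qed.

(** The chain rule for the value at a point that itself varies. *)
Lemma der_horner (w : {poly F}) g :
  d w.[g] = (map_poly d w).[g] + w^`().[g] * d g.
Proof.
have D := map_der_derivation.
elim/poly_ind: w => [|w c IH].
  by rewrite deriv0 !horner0 (der0 der) (der0 D) horner0 mul0r addr0.
rewrite !(derD der, derM der, derD D, derM D, map_derC, map_derX, hornerE, derivE).
by rewrite IH; ring.
Qed.
End CoefDerivation.

Lemma deriv_derivation (F : comNzRingType) : derivation (@deriv F).
Proof. by split=> a b; rewrite ?derivD ?derivM. Qed.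

Lemma map_der_comm (F : comNzRingType) (d d' : F -> F) (w : {poly F}) :
  derivation d -> derivation d' -> (forall a, d (d' a) = d' (d a)) ->
  map_poly d (map_poly d' w) = map_poly d' (map_poly d w).
Proof.
by move=> der der' com; apply/polyP=> i;
  rewrite !(coef_map_der der, coef_map_der der') com.
Qed.

Section Shear.
Variable (F : fieldType).
Implicit Types (g : F) (w : {poly F}).

(** A function of the fibre coordinate T of the chart x <> 0, rewritten in the
    fibre coordinate T + g of the chart y <> 0, which is again called T. *)
Definition shear g w := w \Po ('X - g%:P).

Fact shear_zmod_morphism g : zmod_morphism (shear g).
Proof. by move=> v w; rewrite /shear comp_polyB. Qed.
HB.instance Definition _ g :=
  GRing.isZmodMorphism.Build {poly F} {poly F} (shear g) (shear_zmod_morphism g).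

Fact shear_monoid_morphism g : monoid_morphism (shear g).
Proof. by split=> [|v w]; rewrite /shear ?comp_polyM // -polyC1 comp_polyC. Qed.
HB.instance Definition _ g :=
  GRing.isMonoidMorphism.Build {poly F} {poly F} (shear g) (shear_monoid_morphism g).

Lemma shearC g c : shear g c%:P = c%:P. Proof. exact: comp_polyC. Qed.
Lemma shearX g : shear g 'X = 'X - g%:P. Proof. exact: comp_polyX. Qed.

Lemma shearNK g : cancel (shear (- g)) (shear g).
Proof.
move=> w; rewrite /shear -comp_polyA comp_polyB comp_polyX comp_polyC.
by rewrite polyCN opprK subrK comp_polyXr.
Qed.

Lemma shear_inj g : injective (shear g).
Proof.
apply: (can_inj (g := shear (- g))) => w.
by have := shearNK (- g) w; rewrite opprK.
Qed.

Lemma deriv_shear g w : (shear g w)^`() = shear g w^`().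
Proof. by rewrite /shear deriv_comp derivXsubC mulr1. Qed.

Lemma map_der_shear d g w : derivation d ->
  map_poly d (shear g w) = shear g (map_poly d w) - (d g)%:P * (shear g w)^`().
Proof.
move=> der; have D := map_der_derivation der.
elim/poly_ind: w => [|w c IH].
  by rewrite !(rmorph0, der0 D) deriv0 mulr0 subr0.
rewrite !(rmorphD, rmorphM, derD D, derM D) /= !(map_derC der, map_derX der).
rewrite !(shearC, shearX) rmorph0 !(derB D, map_derC der, map_derX der, IH).
by rewrite !(derivD, derivM, derivN, derivC, derivX); ring.
Qed.

Lemma horner_shear g w c : (shear g w).[c] = w.[c - g].
Proof. by rewrite horner_comp !hornerE. Qed.
End Shear.

Section Primitive.
Variable (F : fieldType).
Hypothesis char0 : forall n, n.+1%:R != 0 :> F.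

Definition primitive (w : {poly F}) : {poly F} :=
  \poly_(i < (size w).+1) (w`_i.-1 / i%:R *+ (0 < i)%N).

Lemma deriv_primitive w : (primitive w)^`() = w.
Proof.
apply/polyP=> i; rewrite coef_deriv coef_poly ltnS.
case: ltnP => [_|/leq_sizeP-> //]; last by rewrite mul0rn.
by rewrite mulr1n -[LHS]mulr_natr mulfVK.
Qed.

Lemma primitive0 w : (primitive w).[0] = 0.
Proof. by rewrite horner_coef0 coef_poly mulr0n. Qed.

Lemma deriv_inj_at0 (v w : {poly F}) : v^`() = w^`() -> v.[0] = w.[0] -> v = w.
Proof.
move=> E; rewrite !horner_coef0 => E0; apply/polyP=> -[//|i].
have /(congr1 (fun p : {poly F} => p`_i)) := E.
rewrite !coef_deriv => H; apply: (mulIf (char0 i)).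
by rewrite [LHS]mulr_natr [RHS]mulr_natr.
Qed.
End Primitive.

(** * The Jacobian bracket of the volume form dx dy dT *)

Definition det3 (R : comNzRingType) (a1 a2 a3 b1 b2 b3 c1 c2 c3 : R) : R :=
  a1 * (b2 * c3 - b3 * c2) - a2 * (b1 * c3 - b3 * c1) + a3 * (b1 * c2 - b2 * c1).

(** Multiplicativity of the determinant, each row of the product being known only
    up to a factor: these factors are powers of a denominator. *)
Lemma det3_mul (R : comNzRingType) (k1 k2 k3 : R) a1 a2 a3 b1 b2 b3 c1 c2 c3
    u1 u2 u3 v1 v2 v3 w1 w2 w3 x1 x2 x3 y1 y2 y3 z1 z2 z3 :
  k1 * a1 = u1 * x1 + u2 * y1 + u3 * z1 ->
  k1 * a2 = u1 * x2 + u2 * y2 + u3 * z2 ->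
  k1 * a3 = u1 * x3 + u2 * y3 + u3 * z3 ->
  k2 * b1 = v1 * x1 + v2 * y1 + v3 * z1 ->
  k2 * b2 = v1 * x2 + v2 * y2 + v3 * z2 ->
  k2 * b3 = v1 * x3 + v2 * y3 + v3 * z3 ->
  k3 * c1 = w1 * x1 + w2 * y1 + w3 * z1 ->
  k3 * c2 = w1 * x2 + w2 * y2 + w3 * z2 ->
  k3 * c3 = w1 * x3 + w2 * y3 + w3 * z3 ->
  k1 * k2 * k3 * det3 a1 a2 a3 b1 b2 b3 c1 c2 c3 =
  det3 u1 u2 u3 v1 v2 v3 w1 w2 w3 * det3 x1 x2 x3 y1 y2 y3 z1 z2 z3.
Proof.
move=> A1 A2 A3 B1 B2 B3 C1 C2 C3.
transitivity (det3 (k1 * a1) (k1 * a2) (k1 * a3) (k2 * b1) (k2 * b2) (k2 * b3)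
  (k3 * c1) (k3 * c2) (k3 * c3)); first by rewrite /det3; ring.
by rewrite A1 A2 A3 B1 B2 B3 C1 C2 C3 /det3; ring.
Qed.

Section Bracket.
Variables (F : fieldType) (dx dy : F -> F).
Hypotheses (derx : derivation dx) (dery : derivation dy).
Hypothesis comm : forall a, dx (dy a) = dy (dx a).
Local Notation B := {poly F}.
Local Notation Dx := (map_poly dx).
Local Notation Dy := (map_poly dy).
Local Notation Dt := (@deriv F).
Let Derx := map_der_derivation derx.
Let Dery := map_der_derivation dery.
Let Dert := @deriv_derivation F.

(** The ratio of df dg dh to the volume form dx dy dT. *)
Definition nambu (f g h : B) : B :=
  det3 (Dx f) (Dy f) (Dt f) (Dx g) (Dy g) (Dt g) (Dx h) (Dy h) (Dt h).

Definition vector_field (a b c w : B) : B := a * Dx w + b * Dy w + c * Dt w.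

Definition field_div (a b c : B) : B := Dx a + Dy b + Dt c.

Lemma field_derivation a b c : derivation (vector_field a b c).
Proof.
split=> v w; rewrite /vector_field.
  by rewrite (derD Derx) (derD Dery) (derD Dert); ring.
by rewrite (derM Derx) (derM Dery) (derM Dert); ring.
Qed.

(** Evaluating the Lie derivative of df dg dh = nambu f g h dx dy dT in two ways:
    by the product rule, and through the fact that the Lie derivative of the
    volume form is its multiple by the divergence. *)
Lemma bracket_field a b c f g h : let D := vector_field a b c in
  nambu (D f) g h + nambu f (D g) h + nambu f g (D h) =
  D (nambu f g h) + field_div a b c * nambu f g h.
Proof.
have cxy w := map_der_comm w derx dery comm.
have cxt w := map_der_deriv derx w.
have cyt w := map_der_deriv dery w.
rewrite /= /nambu /det3 /vector_field /field_div.
rewrite !(derD Derx, derD Dery, derD Dert, derN Derx, derN Dery, derN Dert,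
  derM Derx, derM Dery, derM Dert) !(cxt, cyt, cxy).
ring.
Qed.

Lemma shear_bracket g u v w :
  shear g (nambu u v w) = nambu (shear g u) (shear g v) (shear g w).
Proof.
rewrite /nambu /det3 !(map_der_shear _ _ derx, map_der_shear _ _ dery).
rewrite !(rmorphD, rmorphB, rmorphM) /= !deriv_shear; ring.
Qed.

Lemma shear_field g a b c w :
  shear g (vector_field a b c w) =
  vector_field (shear g a) (shear g b)
    (shear g (c + a * (dx g)%:P + b * (dy g)%:P)) (shear g w).
Proof.
rewrite /vector_field !(map_der_shear _ _ derx, map_der_shear _ _ dery).
rewrite !(rmorphD, rmorphB, rmorphM) /= ?shearC !deriv_shear; ring.
Qed.

Lemma shear_divergence g a b c :
  shear g (field_div a b c) =
  field_div (shear g a) (shear g b) (shear g (c + a * (dx g)%:P + b * (dy g)%:P)).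
Proof.
rewrite /field_div !(map_der_shear _ _ derx, map_der_shear _ _ dery).
rewrite !(rmorphD, rmorphB, rmorphM) /= !shearC !derivD !derivM !derivC.
rewrite !deriv_shear; ring.
Qed.
End Bracket.

(** * Laurent polynomials in x and y, and their residue *)

(** A field with two derivations extending d/dx and d/dy on C[x, y]; the outer
    variable of {poly {poly C}} is y.  Keeping this field abstract hides the
    quotient construction of fractions from conversion. *)
Record diff_field (C : fieldType) := DiffField {
  df_sort :> fieldType;
  df_emb : {rmorphism {poly {poly C}} -> df_sort};
  dx : df_sort -> df_sort;
  dy : df_sort -> df_sort;
  emb_inj : injective df_emb;
  dx_derivation : derivation dx;
  dy_derivation : derivation dy;
  dxy_comm : forall w, dx (dy w) = dy (dx w);
  dx_emb : forall P, dx (df_emb P) = df_emb (map_poly (@deriv C) P);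
  dy_emb : forall P, dy (df_emb P) = df_emb P^`()
}.
Arguments df_emb {C} K : rename.
Arguments dx {C K} w : rename.
Arguments dy {C K} w : rename.

Lemma diff_field_exists (C : fieldType) : exists K : diff_field C, True.
Proof.
have derx := map_der_derivation (@deriv_derivation C).
have dery := @deriv_derivation {poly C}.
unshelve eexists (@DiffField C {fraction {poly {poly C}}}
  (@FracField.tofrac {poly {poly C}})
  (frac_deriv (map_poly (@deriv C))) (frac_deriv (@deriv {poly C})) _ _ _ _ _ _) => //.
- by move=> a b /eqP; rewrite tofrac_eq => /eqP.
- exact: frac_deriv_derivation.
- exact: frac_deriv_derivation.
- apply: frac_deriv_comm => //.
  exact: map_der_deriv (@deriv_derivation C).
- exact: frac_deriv_tofrac.
- exact: frac_deriv_tofrac.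
Qed.

Section Laurent.
Variables (C : fieldType) (K : diff_field C).
Local Notation emb := (df_emb K).

Definition xP : {poly {poly C}} := 'X%:P.
Definition yP : {poly {poly C}} := 'X.
Definition fracX : K := emb xP.
Definition fracY : K := emb yP.
Definition fracC (c : C) : K := emb c%:P%:P.

Fact fracC_zmod_morphism : zmod_morphism fracC.
Proof. by move=> a b; rewrite /fracC !rmorphB. Qed.
HB.instance Definition _ := GRing.isZmodMorphism.Build C K fracC fracC_zmod_morphism.
Fact fracC_monoid_morphism : monoid_morphism fracC.
Proof. by split=> [|a b]; rewrite /fracC ?rmorph1 ?rmorphM. Qed.
HB.instance Definition _ := GRing.isMonoidMorphism.Build C K fracC fracC_monoid_morphism.

Lemma xP_neq0 : xP != 0. Proof. by rewrite polyC_eq0 polyX_eq0. Qed.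
Lemma yP_neq0 : yP != 0. Proof. by rewrite polyX_eq0. Qed.
Lemma emb_eq0 P : (emb P == 0) = (P == 0).
Proof. by rewrite -(rmorph0 emb) (inj_eq (@emb_inj _ K)). Qed.
Lemma fracX_neq0 : fracX != 0. Proof. by rewrite emb_eq0 xP_neq0. Qed.
Lemma fracY_neq0 : fracY != 0. Proof. by rewrite emb_eq0 yP_neq0. Qed.

Let derx := @dx_derivation C K.
Let dery := @dy_derivation C K.

Lemma dx_x : dx fracX = 1.
Proof. by rewrite dx_emb (map_derC (@deriv_derivation C)) derivX rmorph1. Qed.
Lemma dx_y : dx fracY = 0.
Proof. by rewrite dx_emb (map_derX (@deriv_derivation C)) rmorph0. Qed.
Lemma dy_x : dy fracX = 0.
Proof. by rewrite dy_emb derivC rmorph0. Qed.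
Lemma dy_y : dy fracY = 1.
Proof. by rewrite dy_emb derivX rmorph1. Qed.
Lemma dx_c c : dx (fracC c) = 0.
Proof. by rewrite dx_emb (map_derC (@deriv_derivation C)) derivC rmorph0. Qed.
Lemma dy_c c : dy (fracC c) = 0.
Proof. by rewrite dy_emb derivC rmorph0. Qed.

Definition loc (s : {poly {poly C}}) : {pred K} :=
  fun w => `[< exists k P, w * emb s ^+ k = emb P >].

Lemma locP s w : reflect (exists k P, w * emb s ^+ k = emb P) (w \in loc s).
Proof. exact: asboolP. Qed.

Lemma loc_emb s a : emb a \in loc s.
Proof. by apply/locP; exists 0%N, a; rewrite expr0 mulr1. Qed.

Lemma loc_subring s : subring_closed (loc s).
Proof.
split; first by rewrite -(rmorph1 emb) loc_emb.
  move=> a b /locP[k [P Ha]] /locP[l [Q Hb]]; apply/locP; exists (k + l)%N.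
  exists (P * s ^+ l - Q * s ^+ k).
  by rewrite exprD rmorphB !rmorphM -Ha -Hb !rmorphXn /=; ring.
move=> a b /locP[k [P Ha]] /locP[l [Q Hb]]; apply/locP; exists (k + l)%N, (P * Q).
by rewrite exprD rmorphM -Ha -Hb; ring.
Qed.

HB.instance Definition _ s := GRing.isSubringClosed.Build _ (loc s) (loc_subring s).

Lemma loc_inv s k : s != 0 -> (emb s ^+ k)^-1 \in loc s.
Proof.
move=> s0; apply/locP; exists k, 1.
by rewrite mulVf ?rmorph1 // expf_neq0 // emb_eq0.
Qed.

Lemma loc_mull s r w : w \in loc s -> w \in loc (s * r).
Proof.
move=> /locP[k [P H]]; apply/locP; exists k, (P * r ^+ k).
by rewrite !rmorphM exprMn mulrA H rmorphXn.
Qed.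

Fact loc_deriv s (d : K -> K) (d' : {poly {poly C}} -> {poly {poly C}}) w :
  derivation d -> (forall P, d (emb P) = emb (d' P)) ->
  w \in loc s -> d w \in loc s.
Proof.
move=> der dE /locP[k [P]] /(congr1 ( *%R^~ (emb s))).
rewrite -mulrA -exprSr -rmorphM => H; apply/locP; exists k.+2.
exists (d' (P * s) * s - k.+1%:R * (P * s) * d' s).
have := congr1 d H; rewrite dE (derM der) (derXn der) dE rmorphB !(rmorphM emb).
move=> <-; rewrite rmorph_nat -rmorphM /= -H [_ ^+ k.+2]exprS [_ ^+ k.+1]exprS.
ring.
Qed.

Lemma loc_dx s w : w \in loc s -> dx w \in loc s.
Proof. exact: loc_deriv (@dx_derivation _ K) (@dx_emb _ K). Qed.
Lemma loc_dy s w : w \in loc s -> dy w \in loc s.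
Proof. exact: loc_deriv (@dy_derivation _ K) (@dy_emb _ K). Qed.

Lemma coef_shift (P : {poly {poly C}}) i j a b :
  (P * xP ^+ i * yP ^+ j)`_(b + j)`_(a + i) = P`_b`_a.
Proof.
rewrite coefMXn ltnNge leq_addl addnK /xP -rmorphXn /= coefMC coefMXn.
by rewrite ltnNge leq_addl addnK.
Qed.

(** c is the coefficient of 1/(xy) in w.  This is a relation because K may have
    elements that are not Laurent polynomials. *)
Definition residue (w : K) (c : C) : Prop :=
  exists N (P : {poly {poly C}}), w * (fracX * fracY) ^+ N.+1 = emb P /\ P`_N`_N = c.

Lemma residue_fun w c c' : residue w c -> residue w c' -> c = c'.
Proof.
move=> [N [P [HP <-]]] [M [Q [HQ <-]]].
have E : P * (xP * yP) ^+ M.+1 = Q * (xP * yP) ^+ N.+1.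
  apply: (@emb_inj _ K); rewrite !rmorphM -HP -HQ !rmorphXn rmorphM -/fracX -/fracY.
  by ring.
have := congr1 (fun R : {poly {poly C}} => R`_(N + M.+1)`_(N + M.+1)) E.
rewrite /= !exprMn !mulrA coef_shift.
by rewrite [in RHS](_ : (N + M.+1 = M + N.+1)%N) ?coef_shift // !addnS addnC.
Qed.

Lemma residueD w w' c c' : residue w c -> residue w' c' -> residue (w + w') (c + c').
Proof.
move=> [N [P [HP <-]]] [M [Q [HQ <-]]]; exists (N + M.+1)%N.
exists (P * xP ^+ M.+1 * yP ^+ M.+1 + Q * xP ^+ N.+1 * yP ^+ N.+1); split.
  rewrite rmorphD !rmorphM -HP -HQ !rmorphXn -/fracX -/fracY -addSn exprD !exprMn.
  by rewrite exprS [fracY ^+ N.+1]exprS; ring.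
by rewrite !coefD coef_shift [(N + M.+1)%N](_ : _ = M + N.+1)%N ?coef_shift // !addnS addnC.
Qed.

Lemma residueN w c : residue w c -> residue (- w) (- c).
Proof.
move=> [N [P [HP <-]]]; exists N, (- P).
by rewrite mulNr HP rmorphN !coefN.
Qed.

Lemma residue_locx w : w \in loc xP -> residue w 0.
Proof.
move=> /locP[k [P HP]]; exists k, (P * xP * yP ^+ k.+1); split.
  by rewrite !rmorphM -HP !rmorphXn -/fracX -/fracY exprMn [fracX ^+ k.+1]exprS; ring.
by rewrite coefMXn ltnSn coef0.
Qed.

Lemma residue_locy w : w \in loc yP -> residue w 0.
Proof.
move=> /locP[k [P HP]]; exists k, (P * yP * xP ^+ k.+1); split.
  by rewrite !rmorphM -HP !rmorphXn -/fracX -/fracY exprMn [fracY ^+ k.+1]exprS; ring.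
by rewrite /xP -rmorphXn /= coefMC coefMXn ltnSn.
Qed.

Lemma loc_xy_pole w : w \in loc (xP * yP) ->
  exists N P, w * (fracX * fracY) ^+ N.+1 = emb P.
Proof.
move=> /locP[k [P]]; rewrite rmorphM -/fracX -/fracY => HP; exists k, (P * (xP * yP)).
by rewrite !rmorphM -HP exprS -/fracX -/fracY; ring.
Qed.

Lemma residue_dx w : w \in loc (xP * yP) -> residue (dx w) 0.
Proof.
move=> /loc_xy_pole[N [P HP]]; exists N.+1.
exists (map_poly (@deriv C) P * xP * yP - N.+1%:R * P * yP); split.
  have := congr1 dx HP; rewrite dx_emb.
  rewrite !(derM derx, derXn derx, dx_x, dx_y) mul1r mulr0 addr0.
  rewrite rmorphB !rmorphM -HP => <-; rewrite rmorph_nat -/fracX -/fracY exprS.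
  by rewrite [_ ^+ N.+1]exprS; ring.
rewrite !coefB /yP coefMX /= coefMX /= -polyC_natr.
rewrite coefMC coefMX /= coefCM coef_map_id0 ?deriv0 // coef_deriv -polyC_natr coefCM.
by rewrite mulr_natl subrr.
Qed.

Lemma residue_dy w : w \in loc (xP * yP) -> residue (dy w) 0.
Proof.
move=> /loc_xy_pole[N [P HP]]; exists N.+1.
exists (P^`() * yP * xP - N.+1%:R * P * xP); split.
  have := congr1 dy HP; rewrite dy_emb.
  rewrite !(derM dery, derXn dery, dy_x, dy_y) mulr1 mul0r add0r.
  rewrite rmorphB !rmorphM -HP => <-; rewrite rmorph_nat -/fracX -/fracY exprS.
  by rewrite [_ ^+ N.+1]exprS; ring.
rewrite !coefB /yP !coefMC !coefMX /= coef_deriv -polyC_natr coefCM -polyC_natr coefCM.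
by rewrite coefMn mulr_natl subrr.
Qed.

(** The difference of the fibre coordinates v / y^n and u / x^m of the bundle
    x^m v - y^n u = p. *)
Definition transition (m n : nat) (p : {poly {poly C}}) : K :=
  emb p / (fracX ^+ m * fracY ^+ n).

Lemma residue_transition m n p : (0 < m)%N -> (0 < n)%N ->
  residue (transition m n p) p`_n.-1`_m.-1.
Proof.
case: m n => [//|m] [//|n] _ _; exists (m + n)%N, (p * xP ^+ n * yP ^+ m); split.
  rewrite !rmorphM !rmorphXn -/fracX -/fracY /transition exprMn -{1}addSn -addnS.
  rewrite exprD [fracY ^+ (m + _)]exprD.
  by field; rewrite !expf_neq0 ?fracX_neq0 ?fracY_neq0.
by rewrite {1}[(m + n)%N]addnC coef_shift.
Qed.

End Laurent.

(** * The ring of regular functions of the bundle *)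

Section Regular.
Variables (C : numFieldType) (K : diff_field C).
Local Notation emb := (df_emb K).
Local Notation xK := (fracX K).
Local Notation yK := (fracY K).
Local Notation cK := (fracC K).
Local Notation B := {poly K}.
Local Notation Sx := (@loc _ K (xP C)).
Local Notation Sy := (@loc _ K (yP C)).
Local Notation Dx := (map_poly (@dx _ K)).
Local Notation Dy := (map_poly (@dy _ K)).
Local Notation bracket := (nambu (@dx _ K) (@dy _ K)).
Local Notation field := (vector_field (@dx _ K) (@dy _ K)).
Local Notation divergence := (field_div (@dx _ K) (@dy _ K)).
Let derx := @dx_derivation _ K.
Let dery := @dy_derivation _ K.
Let Derx := map_der_derivation derx.
Let Dery := map_der_derivation dery.

Lemma charK n : n.+1%:R != 0 :> K.
Proof. by rewrite -(rmorph_nat cK) fmorph_eq0 pnatr_eq0. Qed.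

Lemma polyOver_dx s w : w \is a polyOver (@loc _ K s) -> Dx w \is a polyOver (@loc _ K s).
Proof.
by move=> /polyOverP H; apply/polyOverP => i; rewrite (coef_map_der derx) loc_dx.
Qed.

Lemma polyOver_dy s w : w \is a polyOver (@loc _ K s) -> Dy w \is a polyOver (@loc _ K s).
Proof.
by move=> /polyOverP H; apply/polyOverP => i; rewrite (coef_map_der dery) loc_dy.
Qed.

Lemma polyOver_dT s (w : B) : w \is a polyOver (@loc _ K s) -> w^`() \is a polyOver (@loc _ K s).
Proof. exact: polyOver_deriv. Qed.

Lemma polyOver_bracket s u v w :
  u \is a polyOver (@loc _ K s) -> v \is a polyOver (@loc _ K s) ->
  w \is a polyOver (@loc _ K s) -> bracket u v w \is a polyOver (@loc _ K s).
Proof.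
by move=> Hu Hv Hw; rewrite /nambu /det3 !(rpredD, rpredN, rpredM) ?polyOver_dx
  ?polyOver_dy ?polyOver_dT.
Qed.

Lemma polyOver_field s a b c w :
  a \is a polyOver (@loc _ K s) -> b \is a polyOver (@loc _ K s) ->
  c \is a polyOver (@loc _ K s) -> w \is a polyOver (@loc _ K s) ->
  field a b c w \is a polyOver (@loc _ K s).
Proof.
by move=> Ha Hb Hc Hw; rewrite /vector_field !(rpredD, rpredM) ?polyOver_dx
  ?polyOver_dy ?polyOver_dT.
Qed.

Definition coordX : B := xK%:P.
Definition coordY : B := yK%:P.

Lemma polyOver_embC s P : (emb P)%:P \is a polyOver (@loc _ K s).
Proof. by rewrite polyOverC loc_emb. Qed.

Lemma polyOver_invx k : ((xK ^+ k)^-1)%:P \is a polyOver Sx.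
Proof. by rewrite polyOverC loc_inv ?xP_neq0. Qed.
Lemma polyOver_invy k : ((yK ^+ k)^-1)%:P \is a polyOver Sy.
Proof. by rewrite polyOverC loc_inv ?yP_neq0. Qed.

Lemma polyOver_primitive s w :
  w \is a polyOver (@loc _ K s) -> primitive w \is a polyOver (@loc _ K s).
Proof.
move=> /polyOverP H; apply/polyOverP => i; rewrite coef_poly.
case: ltnP => _; last exact: rpred0.
case: i => [|i]; first by rewrite mulr0n rpred0.
rewrite rpredMn // rpredM // -(rmorph_nat cK) -fmorphV; exact: loc_emb.
Qed.

Section Bundle.
Variable g : K.

(** Regularity over x <> 0, where the fibre coordinate is T, and over y <> 0,
    where it is T + g. *)
Definition reg : {pred B} :=
  fun w => (w \is a polyOver Sx) && (shear g w \is a polyOver Sy).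

Lemma regP w : reflect (w \is a polyOver Sx /\ shear g w \is a polyOver Sy) (w \in reg).
Proof. exact: andP. Qed.

Lemma reg_subring : subring_closed reg.
Proof.
split; first by apply/regP; rewrite rmorph1 !rpred1.
  by move=> v w /regP[? ?] /regP[? ?]; apply/regP; rewrite rmorphB !rpredB.
by move=> v w /regP[? ?] /regP[? ?]; apply/regP; rewrite rmorphM !rpredM.
Qed.
HB.instance Definition _ := GRing.isSubringClosed.Build _ reg reg_subring.

Lemma reg_emb P : (emb P)%:P \in reg.
Proof. by apply/regP; rewrite shearC !polyOver_embC. Qed.

Lemma reg_coordX : coordX \in reg. Proof. exact: reg_emb. Qed.
Lemma reg_coordY : coordY \in reg. Proof. exact: reg_emb. Qed.
Lemma reg_c c : (cK c)%:P \in reg. Proof. exact: reg_emb. Qed.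

Lemma reg_bracket u v w : u \in reg -> v \in reg -> w \in reg -> bracket u v w \in reg.
Proof.
move=> /regP[Hu Hu'] /regP[Hv Hv'] /regP[Hw Hw']; apply/regP.
by rewrite (shear_bracket derx dery) !polyOver_bracket.
Qed.

(** Regularity of the vector field with components a, b, c.  The function
    c + a dg/dx + b dg/dy is its component along T + g in the other chart. *)
Definition regular_field (a b c : B) : Prop :=
  [/\ a \in reg, b \in reg, c \is a polyOver Sx &
      shear g (c + a * (dx g)%:P + b * (dy g)%:P) \is a polyOver Sy].

Lemma reg_field a b c w : regular_field a b c -> w \in reg -> field a b c w \in reg.
Proof.
move=> [/regP[Ha Ha'] /regP[Hb Hb'] Hc Hc'] /regP[Hw Hw']; apply/regP.
by rewrite (shear_field derx dery) !polyOver_field.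
Qed.

(** Integrating the equation of divergence 1 along the fibres, from the zero
    section of one chart to that of the other, writes g as a sum of terms
    without residue. *)
Lemma divergence1_residue a b c : g \in @loc _ K (xP C * yP C) ->
  regular_field a b c -> divergence a b c = 1 -> residue g 0.
Proof.
move=> Hg [/regP[Ha Ha'] /regP[Hb Hb'] Hc Hc'] div1.
set a' := shear g a; set b' := shear g b.
set c' := shear g (c + a * (dx g)%:P + b * (dy g)%:P).
have div1' : divergence a' b' c' = 1.
  by rewrite -(shear_divergence derx dery) div1 rmorph1.
(* In the chart y <> 0, where the zero section T + g = 0 of that chart is T = 0,
   and the zero section of the chart x <> 0 is T = g. *)
pose ia := primitive a'; pose ib := primitive b'.
have E : c' = c'.[0]%:P + 'X - Dx ia - Dy ib.
  apply: (deriv_inj_at0 charK).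
    rewrite !(derivB, derivD) derivC derivX add0r -!map_der_deriv //.
    rewrite !(deriv_primitive charK) -div1' /field_div; ring.
  rewrite !(hornerD, hornerN) hornerC hornerX !horner_coef0.
  rewrite (coef_map_der derx) (coef_map_der dery) -!horner_coef0.
  by rewrite !primitive0 (der0 derx) (der0 dery) addr0 !subr0.
have H0 w : (shear g w).[g] = w.[0] by rewrite horner_shear subrr.
have := congr1 (horner^~ g) E; rewrite {1}/c' H0.
rewrite !(hornerD, hornerN, hornerM, hornerC, hornerX).
have := der_horner derx ia g; have := der_horner dery ib g.
rewrite !(deriv_primitive charK) !H0 => Eb Ea Ec.
have Eg : g = c.[0] - c'.[0] + dx ia.[g] + dy ib.[g].
  rewrite Ea Eb.
  transitivity (c.[0] + a.[0] * dx g + b.[0] * dy g - c'.[0] + (Dx ia).[g] + (Dy ib).[g]).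
    by rewrite Ec; ring.
  by ring.
have xy s : s \is a polyOver Sy -> s \is a polyOver (@loc _ K (xP C * yP C)).
  by move=> /polyOverP H; apply/polyOverP => i; rewrite mulrC loc_mull.
(* The four terms lie in loc x, in loc y, in the image of dx and in that of dy. *)
suff : residue (c.[0] - c'.[0] + dx ia.[g] + dy ib.[g]) (0 - 0 + 0 + 0).
  by rewrite -Eg subrr !addr0.
apply: residueD; last first.
  by apply/residue_dy/rpred_horner => //; apply/polyOver_primitive/xy.
apply: residueD; last first.
  by apply/residue_dx/rpred_horner => //; apply/polyOver_primitive/xy.
apply: residueD; first by apply/residue_locx/rpred_horner/rpred0.
by apply/residueN/residue_locy/rpred_horner/rpred0.
Qed.
End Bundle.
End Regular.

(** * Vanishing of the first cohomology of a nontrivial bundle *)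

Fact poly_lowest (R : nzRingType) (q : {poly R}) : q != 0 ->
  exists k (c : R) r, [/\ c != 0, (k < size q)%N & q = (c%:P + r * 'X) * 'X^k].
Proof.
elim/poly_ind: q => [|q c IH]; first by rewrite eqxx.
have [->|c0 _] := eqVneq c 0; last first.
  exists 0%N, c, q; split=> //; last by rewrite expr0 mulr1 addrC.
  by rewrite size_MXaddC (negPf c0) andbF.
rewrite addr0 => qX0; have q0 : q != 0.
  by apply: contraNneq qX0 => ->; rewrite mul0r.
have [k [c' [r [c'0 kq E]]]] := IH q0; exists k.+1, c', r; split=> //.
  by rewrite size_mulX.
by rewrite exprSr mulrA -E.
Qed.

Fact lowest_term_inverse (F : fieldType) (c x y s r : F) k l i j :
  c != 0 -> x != 0 -> y != 0 ->
  (c * x ^+ k + s * x ^+ k.+1 + r * y) * y ^+ l /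
    (x ^+ (k + i).+1 * y ^+ (l + j).+1) * (c^-1 * x ^+ i * y ^+ j) =
  (x * y)^-1 + c^-1 * s * (y ^+ 1)^-1 + c^-1 * r * (x ^+ k.+1)^-1.
Proof.
move=> c0 x0 y0; rewrite ![_ ^+ _.+1]exprS !exprD.
have [] : [/\ x ^+ k != 0, y ^+ l != 0, x ^+ i != 0 & y ^+ j != 0] by rewrite !expf_neq0.
move: (x ^+ k) (y ^+ l) (x ^+ i) (y ^+ j) => X Y Z W X0 Y0 Z0 W0.
rewrite expr0; field.
by rewrite c0 x0 y0 X0 Y0 Z0 W0.
Qed.

Section Splitting.
Variables (C : numFieldType) (K : diff_field C).
Local Notation emb := (df_emb K).
Local Notation xK := (fracX K).
Local Notation yK := (fracY K).
Local Notation cK := (fracC K).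
Local Notation B := {poly K}.
Local Notation Sx := (@loc _ K (xP C)).
Local Notation Sy := (@loc _ K (yP C)).
Local Notation Sxy := (@loc _ K (xP C * yP C)).
Local Notation bX := (coordX K).
Local Notation bY := (coordY K).
Let xK0 := fracX_neq0 K.
Let yK0 := fracY_neq0 K.

Section OfTransition.
Variable g : K.
Local Notation reg := (reg g).

(** The cocycle s on the overlap of the charts is a coboundary for {x <> 0, y <> 0}. *)
Definition splits (s : B) : Prop :=
  exists w, w \is a polyOver Sx /\ shear g (w - s) \is a polyOver Sy.

Lemma splits_x s : s \is a polyOver Sx -> splits s.
Proof. by move=> H; exists s; rewrite subrr rmorph0 rpred0. Qed.

Lemma splits_y s : shear g s \is a polyOver Sy -> splits s.
Proof. by move=> H; exists 0; rewrite sub0r rmorphN rpredN rpred0. Qed.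

Lemma splitsD s t : splits s -> splits t -> splits (s + t).
Proof.
move=> [v [Hv Hv']] [w [Hw Hw']]; exists (v + w); rewrite rpredD //; split=> //.
by rewrite opprD addrACA rmorphD rpredD.
Qed.

Lemma splits_mul s r : splits s -> r \in reg -> splits (s * r).
Proof.
move=> [v [Hv Hv']] /regP[Hr Hr']; exists (v * r); rewrite rpredM //; split=> //.
by rewrite -mulrBl rmorphM rpredM.
Qed.

Lemma splits_g : splits g%:P.
Proof.
exists (- 'X); rewrite rpredN polyOverX; split=> //.
by rewrite -opprD rmorphN rmorphD /= shearX shearC subrK rpredN polyOverX.
Qed.

(** Once 1/(xy) is a coboundary, x and y generate the unit ideal of the ring
    of regular functions, and high powers of the resulting relation make every
    cocycle a coboundary. *)
Lemma splits_bezout : splits (xK * yK)^-1%:P ->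
  exists u v, [/\ u \in reg, v \in reg & bY * u - bX * v = 1].
Proof.
move=> [w [Hw Hw']]; exists (bX * w), (bY * (w - (xK * yK)^-1%:P)); split.
- apply/regP; split; first by rewrite rpredM // polyOver_embC.
  have -> : bX * w = bX * (w - (xK * yK)^-1%:P) + (yK ^+ 1)^-1%:P.
    by rewrite mulrBr -polyCM invfM mulrA divff // mul1r expr1 subrK.
  rewrite rmorphD rmorphM /= !shearC rpredD ?rpredM ?polyOver_embC //.
  exact: polyOver_invy.
- apply/regP; split; last by rewrite rmorphM /= shearC rpredM ?polyOver_embC.
  rewrite mulrBr -polyCM invfM mulrCA divff // mulr1.
  rewrite rpredB ?rpredM ?polyOver_embC // -[xK]expr1; exact: polyOver_invx.
transitivity (bX * bY * (xK * yK)^-1%:P); first by ring.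
by rewrite /coordX /coordY -!polyCM divff ?mulf_neq0.
Qed.

Lemma splits_pole N : splits (xK * yK)^-1%:P -> splits ((xK * yK) ^+ N)^-1%:P.
Proof.
move=> /splits_bezout[u [v' [Hu Hv' E]]]; pose v := - v'.
have Hv : v \in reg by rewrite rpredN.
set pole := _%:P.
have poleY : bY ^+ N * pole = (xK ^+ N)^-1%:P.
  by rewrite /pole /coordY -polyC_exp -polyCM exprMn invfM mulrCA divff ?mulr1 ?expf_neq0.
have poleX : bX ^+ N * pole = (yK ^+ N)^-1%:P.
  by rewrite /pole /coordX -polyC_exp -polyCM exprMn invfM mulrA divff ?mul1r ?expf_neq0.
have -> : pole = (bY * u + bX * v) ^+ (N + N) * pole.
  by rewrite mulrN E expr1n mul1r.
rewrite exprDn mulr_suml; elim/big_ind: _ => [|s t|i _].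
- by apply: splits_x; rewrite rpred0.
- exact: splitsD.
have bXreg := reg_coordX g; have bYreg := reg_coordY g.
rewrite -mulr_natr !exprMn; set c := _%:R.
have [iN|Ni] := leqP i N.
  have -> : (N + N - i = N + (N - i))%N by lia.
  set k := (N - i)%N.
  have -> : bY ^+ (N + k) * u ^+ (N + k) * (bX ^+ i * v ^+ i) * c * pole
    = bY ^+ N * pole * (bY ^+ k * u ^+ (N + k) * (bX ^+ i * v ^+ i) * c).
    by rewrite exprD; ring.
  rewrite poleY; apply: splits_mul; last by rewrite !(rpredM, rpredX, rpred_nat).
  by apply: splits_x; exact: polyOver_invx.
rewrite -(subnKC (ltnW Ni)); set k := (i - N)%N; set l := (N + N - _)%N.
have -> : bY ^+ l * u ^+ l * (bX ^+ (N + k) * v ^+ (N + k)) * c * pole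
  = bX ^+ N * pole * (bY ^+ l * u ^+ l * (bX ^+ k * v ^+ (N + k)) * c).
  by rewrite exprD; ring.
rewrite poleX; apply: splits_mul; last by rewrite !(rpredM, rpredX, rpred_nat).
by apply: splits_y; rewrite shearC; exact: polyOver_invy.
Qed.

Lemma splits_loc s : splits (xK * yK)^-1%:P -> s \in Sxy -> splits s%:P.
Proof.
move=> H /locP[N [P HP]].
have -> : s%:P = ((xK * yK) ^+ N)^-1%:P * (emb P)%:P.
  by rewrite -HP (rmorphM emb) -polyCM mulrCA mulVf ?mulr1 // expf_neq0 ?mulf_neq0.
by apply: splits_mul; [exact: splits_pole|exact: reg_emb].
Qed.
End OfTransition.

Section Transition.
Variables (m n : nat) (p : {poly {poly C}}).
Hypotheses (m_gt0 : (0 < m)%N) (n_gt0 : (0 < n)%N).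
Hypotheses (degx : forall j, (size (p`_j)%R <= m)%N) (degy : (size p <= n)%N).
Local Notation g := (transition K m n p).
Local Notation reg := (reg g).

Lemma transition_loc : g \in Sxy.
Proof.
rewrite rpredM ?loc_emb // invfM rpredM //; last by rewrite mulrC loc_mull ?loc_inv ?yP_neq0.
by rewrite loc_mull ?loc_inv ?xP_neq0.
Qed.

(** The lowest term of p, in the lexicographic order, gives a multiple of g
    equal to 1/(xy) up to coboundaries. *)
Lemma splits_socle : p != 0 -> splits g (xK * yK)^-1%:P.
Proof.
move=> /poly_lowest[l [q [r [q0 lp Ep]]]].
have Eq : p`_l = q.
  by rewrite Ep coefMXn ltnn subnn coefD coefMX coefC eqxx addr0.
have [k [c [s [c0 kq Es]]]] := poly_lowest q0.
have lm : (k < m)%N by rewrite (leq_trans kq) // -Eq.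
have ln : (l < n)%N by rewrite (leq_trans lp).
have [m' Em] : exists m', m = (k + m').+1 by exists (m - k).-1; lia.
have [n' En] : exists n', n = (l + n').+1 by exists (n - l).-1; lia.
(* a g has the term 1/(xy), and each other term has no pole in x or none in y. *)
pose a : {poly {poly C}} := (c^-1)%:P%:P * xP C ^+ m' * yP C ^+ n'.
have cK0 : cK c != 0 by rewrite fmorph_eq0.
have Eg : g * emb a = (xK * yK)^-1
   + (cK c)^-1 * emb s%:P * (yK ^+ 1)^-1 + (cK c)^-1 * emb r * (xK ^+ k.+1)^-1.
  have Epk : emb p = (cK c * xK ^+ k + emb s%:P * xK ^+ k.+1 + emb r * yK) * yK ^+ l.
    have -> : p = (c%:P%:P * xP C ^+ k + s%:P * xP C ^+ k.+1 + r * yP C) * yP C ^+ l.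
      by rewrite Ep Es /xP /yP !polyCM polyCD polyCM !rmorphXn /= exprS; ring.
    by rewrite !(rmorphM emb, rmorphD emb) !(rmorphXn emb).
  rewrite /transition Epk /a !rmorphM !rmorphXn /= -/(cK c^-1) fmorphV Em En.
  exact: lowest_term_inverse.
have -> : (xK * yK)^-1%:P = g%:P * (emb a)%:P
  + - ((cK c)^-1 * emb s%:P * (yK ^+ 1)^-1)%:P - ((cK c)^-1 * emb r * (xK ^+ k.+1)^-1)%:P.
  by rewrite -polyCM Eg !polyCD; ring.
apply: splitsD; first apply: splitsD.
- by apply: splits_mul; [exact: splits_g|exact: reg_emb].
- apply: splits_y; rewrite rmorphN /= shearC rpredN polyOverC -fmorphV.
  by rewrite !rpredM ?loc_emb ?loc_inv ?yP_neq0.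
apply: splits_x; rewrite rpredN polyOverC -fmorphV.
by rewrite !rpredM ?loc_emb ?loc_inv ?xP_neq0.
Qed.

Lemma splits_all s : p != 0 -> s \in Sxy -> splits g s%:P.
Proof. by move=> /splits_socle H Hs; exact: splits_loc. Qed.

Definition coordU : B := bX ^+ m * 'X.
Definition coordV : B := bY ^+ n * ('X + g%:P).

Lemma shear_coordV : shear g coordV = bY ^+ n * 'X.
Proof. by rewrite rmorphM rmorphXn rmorphD /= shearX !shearC subrK. Qed.

Lemma reg_coordU : coordU \in reg.
Proof.
apply/regP; split; first by rewrite rpredM ?rpredX ?polyOverX ?polyOver_embC.
have -> : shear g coordU = bX ^+ m * 'X - (emb p)%:P * (yK ^+ n)^-1%:P.
  rewrite rmorphM rmorphXn /= shearX !shearC mulrBr; congr (_ - _).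
  by rewrite /coordX -polyC_exp -!polyCM /transition invfM mulrCA mulVKf ?expf_neq0.
by rewrite rpredB // rpredM ?rpredX ?polyOverX ?polyOver_embC ?polyOver_invy.
Qed.

Lemma reg_coordV : coordV \in reg.
Proof.
apply/regP; rewrite shear_coordV; split; last by rewrite rpredM ?rpredX ?polyOverX ?polyOver_embC.
have -> : coordV = bY ^+ n * 'X + (emb p)%:P * (xK ^+ m)^-1%:P.
  rewrite /coordV mulrDr; congr (_ + _).
  by rewrite /coordY -polyC_exp -!polyCM /transition [xK ^+ m * _]mulrC invfM mulrCA mulVKf ?expf_neq0.
by rewrite rpredD // rpredM ?rpredX ?polyOverX ?polyOver_embC ?polyOver_invx.
Qed.
End Transition.
End Splitting.

(** * Exactness of the volume form when the residue vanishes *)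

Section Exactness.
Variables (C : numFieldType) (K : diff_field C).
Local Notation emb := (df_emb K).
Local Notation xK := (fracX K).
Local Notation yK := (fracY K).
Local Notation cK := (fracC K).
Local Notation B := {poly K}.
Local Notation Sxy := (@loc _ K (xP C * yP C)).
Local Notation bX := (coordX K).
Local Notation bY := (coordY K).
Local Notation Dx := (map_poly (@dx _ K)).
Local Notation Dy := (map_poly (@dy _ K)).
Local Notation bracket := (nambu (@dx _ K) (@dy _ K)).
Local Notation divergence := (field_div (@dx _ K) (@dy _ K)).
Let derx := @dx_derivation _ K.
Let dery := @dy_derivation _ K.
Let Derx := map_der_derivation derx.
Let Dery := map_der_derivation dery.
Let xK0 := fracX_neq0 K.
Let yK0 := fracY_neq0 K.

Variables (m n : nat) (p : {poly {poly C}}).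
Hypotheses (m_gt0 : (0 < m)%N) (n_gt0 : (0 < n)%N).
Hypotheses (degx : forall j, (size (p`_j)%R <= m)%N) (degy : (size p <= n)%N).
Local Notation g := (transition K m n p).
Local Notation reg := (reg g).
Local Notation bU := (coordU K m).
Local Notation bV := (coordV K m n p).

Lemma loc_monomial c i j : cK c * xK ^+ i * yK ^+ j / (xK ^+ m * yK ^+ n) \in Sxy.
Proof.
have := transition_loc K m n (c%:P%:P * xP C ^+ i * yP C ^+ j).
by rewrite /transition !(rmorphM emb) !(rmorphXn emb).
Qed.

(** Splitting 1/(x^m y^n) between the two charts and clearing denominators. *)
Lemma unimodular : p != 0 ->
  exists u v, [/\ u \in reg, v \in reg & bX ^+ m * v - bY ^+ n * u = 1].
Proof.
move=> p0; pose s := (xK ^+ m * yK ^+ n)^-1.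
have Hs : s \in Sxy.
  by have := loc_monomial 1 0 0; rewrite rmorph1 !expr0 !mul1r.
have [w [Hw Hw']] := splits_all m_gt0 n_gt0 degx degy p0 Hs.
have mn0 : xK ^+ m * yK ^+ n != 0 by rewrite mulf_neq0 ?expf_neq0.
have Es : bX ^+ m * bY ^+ n * s%:P = 1.
  by rewrite /coordX /coordY -!polyC_exp -!polyCM divff.
have Ex : bX ^+ m * s%:P = (yK ^+ n)^-1%:P.
  by rewrite /coordX -polyC_exp -polyCM /s invfM mulrA divff ?mul1r ?expf_neq0.
have Ey : bY ^+ n * s%:P = (xK ^+ m)^-1%:P.
  by rewrite /coordY -polyC_exp -polyCM /s invfM mulrCA divff ?mulr1 ?expf_neq0.
exists (- (bX ^+ m * w)), (- (bY ^+ n * (w - s%:P))); split; rewrite ?rpredN.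
- apply/regP; split; first by rewrite rpredM ?rpredX ?polyOver_embC.
  have -> : bX ^+ m * w = bX ^+ m * (w - s%:P) + (yK ^+ n)^-1%:P by rewrite -Ex; ring.
  by rewrite rmorphD rmorphM rmorphXn /= !shearC rpredD ?polyOver_invy // rpredM ?rpredX ?polyOver_embC.
- apply/regP; split; last by rewrite rmorphM rmorphXn /= shearC rpredM ?rpredX ?polyOver_embC.
  by rewrite mulrBr Ey rpredB ?polyOver_invx // rpredM ?rpredX ?polyOver_embC.
by rewrite -Es; ring.
Qed.

Lemma bracket_XYU : bracket bX bY bU = bX ^+ m.
Proof.
rewrite /nambu /det3 /coordU /coordX /coordY.
rewrite !(derM Derx, derM Dery) !derivM -!polyC_exp !(map_derC derx, map_derC dery).
rewrite dx_x dx_y dy_x dy_y !derivC !derivX polyC1 polyC0.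
ring.
Qed.

Lemma bracket_XYV : bracket bX bY bV = bY ^+ n.
Proof.
rewrite /nambu /det3 /coordV /coordX /coordY.
rewrite !(derM Derx, derM Dery) !derivM -!polyC_exp !(map_derC derx, map_derC dery).
rewrite dx_x dx_y dy_x dy_y !derivD !derivC !derivX polyC1 polyC0.
ring.
Qed.

Definition exact_on_overlap (s : K) :=
  exists P Q, [/\ P \in Sxy, Q \in Sxy & s = dx P + dy Q].

Fact euler_Xn (F : fieldType) (d : F -> F) a k : derivation d -> d a = 1 ->
  d (a ^+ k) * a = k%:R * a ^+ k.
Proof.
move=> der da; case: k => [|k]; first by rewrite expr0 (der1 der) !mul0r.
by rewrite (derXn der) da mulr1 -mulrA -exprSr.
Qed.

Fact der_cst_Xn (F : comNzRingType) (d : F -> F) a k : derivation d -> d a = 0 ->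
  d (a ^+ k) = 0.
Proof. by move=> der da; case: k => [|k]; rewrite ?(der1 der) ?(derXn der) ?da ?mulr0. Qed.

Lemma euler_dx c i j (w := cK c * xK ^+ i * yK ^+ j / (xK ^+ m * yK ^+ n)) :
  dx w * xK = (i%:R - m%:R) * w.
Proof.
have mn0 : xK ^+ m * yK ^+ n != 0 by rewrite mulf_neq0 ?expf_neq0.
have Ew : w * (xK ^+ m * yK ^+ n) = cK c * xK ^+ i * yK ^+ j by rewrite divfK.
have := congr1 dx Ew.
rewrite !(derM derx) dx_c !(der_cst_Xn _ derx (dx_y K)).
move=> /(congr1 ( *%R^~ xK)) E; apply: (mulIf mn0).
have Ei := euler_Xn i derx (dx_x K); have Em := euler_Xn m derx (dx_x K).
rewrite mulrBl mulrBl -[i%:R * w * _]mulrA Ew.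
transitivity (cK c * (i%:R * xK ^+ i) * yK ^+ j - w * (m%:R * xK ^+ m) * yK ^+ n); last by ring.
rewrite -Ei -Em; apply/eqP; rewrite eq_sym subr_eq; apply/eqP.
transitivity (((0 * xK ^+ i + cK c * dx (xK ^+ i)) * yK ^+ j + cK c * xK ^+ i * 0) * xK).
  by ring.
by rewrite -E; ring.
Qed.

Lemma euler_dy c i j (w := cK c * xK ^+ i * yK ^+ j / (xK ^+ m * yK ^+ n)) :
  dy w * yK = (j%:R - n%:R) * w.
Proof.
have mn0 : xK ^+ m * yK ^+ n != 0 by rewrite mulf_neq0 ?expf_neq0.
have Ew : w * (xK ^+ m * yK ^+ n) = cK c * xK ^+ i * yK ^+ j by rewrite divfK.
have := congr1 dy Ew.
rewrite !(derM dery) dy_c !(der_cst_Xn _ dery (dy_x K)).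
move=> /(congr1 ( *%R^~ yK)) E; apply: (mulIf mn0).
have Ej := euler_Xn j dery (dy_y K); have En := euler_Xn n dery (dy_y K).
rewrite mulrBl mulrBl -[j%:R * w * _]mulrA Ew.
transitivity (cK c * xK ^+ i * (j%:R * yK ^+ j) - w * xK ^+ m * (n%:R * yK ^+ n)); last by ring.
rewrite -Ej -En; apply/eqP; rewrite eq_sym subr_eq; apply/eqP.
transitivity (((0 * xK ^+ i + cK c * 0) * yK ^+ j + cK c * xK ^+ i * dy (yK ^+ j)) * yK).
  by ring.
by rewrite -E; ring.
Qed.

(** Every Laurent monomial but 1/(xy) has an antiderivative in x or in y. *)
Lemma exact_monomial c i j : (i.+1 != m) || (j.+1 != n) ->
  exact_on_overlap (cK c * xK ^+ i * yK ^+ j / (xK ^+ m * yK ^+ n)).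
Proof.
have char0 a b : a != b -> a%:R - b%:R != 0 :> C by rewrite subr_eq0 eqr_nat.
have cKB a b : cK (a%:R - b%:R) = a%:R - b%:R by rewrite rmorphB !rmorph_nat.
case/orP => /char0 ne.
  exists (cK (c / (i.+1%:R - m%:R)) * xK ^+ i.+1 * yK ^+ j / (xK ^+ m * yK ^+ n)), 0.
  rewrite loc_monomial rpred0 (der0 dery) addr0; split=> //; apply: (mulIf xK0).
  rewrite euler_dx -cKB; transitivity (cK (i.+1%:R - m%:R) * cK (c / (i.+1%:R - m%:R)) *
      xK ^+ i.+1 * yK ^+ j / (xK ^+ m * yK ^+ n)); last by rewrite !mulrA.
  by rewrite -rmorphM [_ * (c / _)]mulrC divfK // exprS; ring.
exists 0, (cK (c / (j.+1%:R - n%:R)) * xK ^+ i * yK ^+ j.+1 / (xK ^+ m * yK ^+ n)).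
rewrite loc_monomial rpred0 (der0 derx) add0r; split=> //; apply: (mulIf yK0).
rewrite euler_dy -cKB; transitivity (cK (j.+1%:R - n%:R) * cK (c / (j.+1%:R - n%:R)) *
    xK ^+ i * yK ^+ j.+1 / (xK ^+ m * yK ^+ n)); last by rewrite !mulrA.
by rewrite -rmorphM [_ * (c / _)]mulrC divfK // exprS; ring.
Qed.

Lemma exact_transition : p`_n.-1`_m.-1 = 0 -> exact_on_overlap g.
Proof.
move=> res0.
have -> : g = \sum_(j < size p) \sum_(i < size (p`_j))
    cK p`_j`_i * xK ^+ i * yK ^+ j / (xK ^+ m * yK ^+ n).
  rewrite /transition -[p in LHS]coefK poly_def rmorph_sum mulr_suml.
  apply: eq_bigr => j _.
  rewrite -mul_polyC (rmorphM emb) (rmorphXn emb) -[emb 'X]/yK.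
  rewrite -[p`_j in LHS]coefK poly_def rmorph_sum rmorph_sum !mulr_suml.
  apply: eq_bigr => i _.
  by rewrite /= -[_ *: _]mul_polyC polyCM (rmorphM emb) polyC_exp (rmorphXn emb).
elim/big_ind: _ => [|s t [P [Q [HP HQ ->]]] [P' [Q' [HP' HQ' ->]]]|j _].
- by exists 0, 0; rewrite !rpred0 (der0 derx) (der0 dery) addr0.
- exists (P + P'), (Q + Q'); rewrite !rpredD // (derD derx) (derD dery).
  by split=> //; ring.
elim/big_ind: _ => [|s t [P [Q [HP HQ ->]]] [P' [Q' [HP' HQ' ->]]]|i _].
- by exists 0, 0; rewrite !rpred0 (der0 derx) (der0 dery) addr0.
- exists (P + P'), (Q + Q'); rewrite !rpredD // (derD derx) (derD dery).
  by split=> //; ring.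
have [Em|] := eqVneq i.+1 m; last by move=> H; apply: exact_monomial; rewrite H.
have [En|] := eqVneq j.+1 n; last by move=> H; apply: exact_monomial; rewrite H orbT.
exists 0, 0; rewrite !rpred0 (der0 derx) (der0 dery) addr0; split=> //.
by rewrite -[nat_of_ord i]/(i.+1.-1) -[nat_of_ord j]/(j.+1.-1) Em En res0 rmorph0 !mul0r.
Qed.

(** A primitive of g on the overlap, split between the two charts, corrects
    the Euler field T d/dT of either chart into a global field. *)
Lemma divergence1_field : p != 0 -> p`_n.-1`_m.-1 = 0 ->
  exists a b c, regular_field g a b c /\ divergence a b c = 1.
Proof.
move=> p0 /exact_transition[P [Q [HP HQ Eg]]].
have [u [Hu Hu']] := splits_all m_gt0 n_gt0 degx degy p0 HP.
have [v [Hv Hv']] := splits_all m_gt0 n_gt0 degx degy p0 HQ.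
have cxt := map_der_deriv derx; have cyt := map_der_deriv dery.
exists (- u^`()), (- v^`()), ('X + Dx u + Dy v); split; last first.
  rewrite /field_div (derN Derx) (derN Dery) !derivD derivX cxt cyt; ring.
have dC (w : B) r : (w - r%:P)^`() = w^`() by rewrite derivB derivC subr0.
split.
- rewrite rpredN; apply/regP; rewrite polyOver_dT //; split=> //.
  by rewrite -(dC u P) -deriv_shear polyOver_dT.
- rewrite rpredN; apply/regP; rewrite polyOver_dT //; split=> //.
  by rewrite -(dC v Q) -deriv_shear polyOver_dT.
- by rewrite !rpredD ?polyOverX ?polyOver_dx ?polyOver_dy.
have -> : shear g ('X + Dx u + Dy v + - u^`() * (dx g)%:P + - v^`() * (dy g)%:P) =
    'X + Dx (shear g (u - P%:P)) + Dy (shear g (v - Q%:P)).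
  rewrite !(map_der_shear _ _ derx, map_der_shear _ _ dery) !deriv_shear !dC.
  rewrite (derB Derx) (derB Dery) (map_derC derx) (map_derC dery).
  rewrite !(rmorphD, rmorphM, rmorphB, rmorphN) /= !shearC shearX {1}Eg polyCD.
  ring.
by rewrite !rpredD ?polyOverX ?polyOver_dx ?polyOver_dy.
Qed.

Lemma divergence1_coef a b c :
  regular_field g a b c -> divergence a b c = 1 -> p`_n.-1`_m.-1 = 0.
Proof.
move=> H H1; apply: (residue_fun (residue_transition K p m_gt0 n_gt0)).
exact: divergence1_residue (transition_loc K m n p) H H1.
Qed.

End Exactness.

(** * Isomorphisms of rings of regular functions *)

Section Transport.
Variables (C : numFieldType) (K : diff_field C).
Local Notation emb := (df_emb K).
Local Notation cK := (fracC K).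
Local Notation B := {poly K}.
Local Notation Sx := (@loc _ K (xP C)).
Local Notation bX := (coordX K).
Local Notation bY := (coordY K).
Local Notation bU := (coordU K).
Local Notation Dx := (map_poly (@dx _ K)).
Local Notation Dy := (map_poly (@dy _ K)).
Local Notation bracket := (nambu (@dx _ K) (@dy _ K)).
Local Notation field := (vector_field (@dx _ K) (@dy _ K)).
Let derx := @dx_derivation _ K.
Let dery := @dy_derivation _ K.
Let Derx := map_der_derivation derx.
Let Dery := map_der_derivation dery.
Let Dert := @deriv_derivation K.

(** A homomorphism of C-algebras between rings of regular functions, given as
    a total map of which only the restriction to the source matters. *)
Record alg_hom (g g' : K) (theta : B -> B) : Prop := AlgHom {
  hom_reg : forall w, w \in reg g -> theta w \in reg g';
  homD : forall v w, v \in reg g -> w \in reg g -> theta (v + w) = theta v + theta w;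
  homM : forall v w, v \in reg g -> w \in reg g -> theta (v * w) = theta v * theta w;
  homC : forall c, theta (cK c)%:P = (cK c)%:P
}.

Section Hom.
Variables (g g' : K) (theta : B -> B).
Hypothesis hom : alg_hom g g' theta.

Lemma hom0 : theta 0 = 0.
Proof. by have := homC hom 0; rewrite rmorph0. Qed.
Lemma hom1 : theta 1 = 1.
Proof. by have := homC hom 1; rewrite rmorph1. Qed.

Lemma homN v : v \in reg g -> theta (- v) = - theta v.
Proof.
move=> Hv; apply/eqP; rewrite -addr_eq0 -(homD hom) ?rpredN //.
by rewrite addNr hom0.
Qed.

Lemma homXn v k : v \in reg g -> theta (v ^+ k) = theta v ^+ k.
Proof.
move=> Hv; elim: k => [|k IH]; first by rewrite !expr0 hom1.
by rewrite !exprS (homM hom) ?rpredX // IH.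
Qed.

Lemma hom_det3 a1 a2 a3 b1 b2 b3 c1 c2 c3 :
  a1 \in reg g -> a2 \in reg g -> a3 \in reg g ->
  b1 \in reg g -> b2 \in reg g -> b3 \in reg g ->
  c1 \in reg g -> c2 \in reg g -> c3 \in reg g ->
  theta (det3 a1 a2 a3 b1 b2 b3 c1 c2 c3) =
  det3 (theta a1) (theta a2) (theta a3) (theta b1) (theta b2) (theta b3)
    (theta c1) (theta c2) (theta c3).
Proof.
move=> *; rewrite /det3.
by rewrite !(homD hom, homM hom, homN) ?(rpredD, rpredN, rpredM).
Qed.
End Hom.

(** Polynomials in x, y, u = x^m T.  They are all regular, and every regular
    function becomes one of them after multiplication by a power of x. *)
Inductive coordinate_poly (m : nat) : B -> Prop :=
| cp_c c : coordinate_poly m (cK c)%:P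
| cp_X : coordinate_poly m bX
| cp_Y : coordinate_poly m bY
| cp_U : coordinate_poly m (bU m)
| cp_add v w : coordinate_poly m v -> coordinate_poly m w -> coordinate_poly m (v + w)
| cp_mul v w : coordinate_poly m v -> coordinate_poly m w -> coordinate_poly m (v * w).

Lemma cp_exp m w k : coordinate_poly m w -> coordinate_poly m (w ^+ k).
Proof.
move=> H; elim: k => [|k IH]; last by rewrite exprS; exact: cp_mul.
by rewrite expr0 -(rmorph1 (polyC : K -> B)) -(rmorph1 cK); exact: cp_c.
Qed.

Lemma cp_emb m P : coordinate_poly m (emb P)%:P.
Proof.
have cp0 : coordinate_poly m 0.
  by rewrite -(rmorph0 (polyC : K -> B)) -(rmorph0 cK); exact: cp_c.
elim/poly_ind: P => [|P q IH]; first by rewrite !rmorph0.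
rewrite (rmorphD emb) (rmorphM emb) polyCD polyCM; apply: cp_add.
  by apply: cp_mul => //; exact: cp_Y.
elim/poly_ind: q => [|q c IHq]; first by rewrite !rmorph0.
rewrite polyCD polyCM (rmorphD emb) (rmorphM emb) polyCD polyCM; apply: cp_add.
  by apply: cp_mul => //; exact: cp_X.
exact: cp_c.
Qed.

Lemma polyOver_cp m w : w \is a polyOver Sx -> exists k, coordinate_poly m (bX ^+ k * w).
Proof.
elim/poly_ind: w => [|w c IH].
  move=> _; exists 0%N; rewrite mulr0 -(rmorph0 (polyC : K -> B)) -(rmorph0 cK).
  exact: cp_c.
move=> /polyOverP H.
have /IH [k Hk] : w \is a polyOver Sx.
  by apply/polyOverP => i; have := H i.+1; rewrite coefD coefMX coefC addr0.
have /locP[l [P HP]] : c \in Sx by have := H 0%N; rewrite coefD coefMX coefC add0r.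
exists (k + m + l)%N.
have -> : bX ^+ (k + m + l) * (w * 'X + c%:P) =
   bX ^+ k * w * bU m * bX ^+ l + (emb P)%:P * bX ^+ (k + m).
  rewrite -HP polyCM polyC_exp -[(emb (xP C))%:P]/bX /coordU !exprD; ring.
apply: cp_add; apply: cp_mul; try exact: cp_emb; try by apply/cp_exp/cp_X.
by apply: cp_mul => //; exact: cp_U.
Qed.

Lemma cp_reg m n p z : (0 < m)%N -> (0 < n)%N ->
  coordinate_poly m z -> z \in reg (transition K m n p).
Proof.
move=> m0 n0; elim=> [c||||v w _ Hv _ Hw|v w _ Hv _ Hw].
- exact: reg_c.
- exact: reg_coordX.
- exact: reg_coordY.
- exact: reg_coordU.
- exact: rpredD.
- exact: rpredM.
Qed.

(** A derivation of the ring of regular functions is determined by its values on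
    x, y, u, as x is not a zero divisor. *)
Lemma field_unique m n p (D : B -> B) a b c (g := transition K m n p) :
  (0 < m)%N -> (0 < n)%N ->
  (forall v w, v \in reg g -> w \in reg g -> D (v + w) = D v + D w) ->
  (forall v w, v \in reg g -> w \in reg g -> D (v * w) = D v * w + v * D w) ->
  (forall c, D (cK c)%:P = 0) ->
  D bX = field a b c bX -> D bY = field a b c bY -> D (bU m) = field a b c (bU m) ->
  forall w, w \in reg g -> D w = field a b c w.
Proof.
move=> m0 n0 DD DM DC DX DY DU w Hw.
have [Fd Fm] := field_derivation derx dery a b c.
have E z : coordinate_poly m z -> D z = field a b c z.
  elim=> {z} [e||||v z Hv Ev Hz Ez|v z Hv Ev Hz Ez].
  - rewrite DC /vector_field (map_derC derx) (map_derC dery) derivC dx_c dy_c polyC0.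
    by rewrite !mulr0 !addr0.
  - exact: DX.
  - exact: DY.
  - exact: DU.
  - by rewrite DD ?Fd ?Ev ?Ez //; exact: cp_reg.
  - by rewrite DM ?Fm ?Ev ?Ez //; exact: cp_reg.
have [k Hk] : exists k, coordinate_poly m (bX ^+ k * w).
  by apply: polyOver_cp; case/regP: Hw.
have bX0 : bX ^+ k != 0 by rewrite expf_neq0 // polyC_eq0 fracX_neq0.
have bXr : bX ^+ k \in reg g by rewrite rpredX ?reg_coordX.
have := E _ Hk; rewrite Fm DM // E; last by apply/cp_exp/cp_X.
by move=> /addrI /(mulfI bX0).
Qed.

Section Jacobian.
Variables (m n : nat) (p : {poly {poly C}}) (g' : K) (theta : B -> B).
Hypotheses (m_gt0 : (0 < m)%N) (n_gt0 : (0 < n)%N).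
Local Notation g := (transition K m n p).
Hypothesis hom : alg_hom g g' theta.

Definition der_over_C (d : B -> B) := derivation d /\ forall c, d (cK c)%:P = 0.

Lemma Dx_over_C : der_over_C Dx.
Proof. by split=> // c; rewrite (map_derC derx) dx_c polyC0. Qed.
Lemma Dy_over_C : der_over_C Dy.
Proof. by split=> // c; rewrite (map_derC dery) dy_c polyC0. Qed.
Lemma Dt_over_C : der_over_C (@deriv K).
Proof. by split=> // c; rewrite derivC. Qed.

(** The differential of a regular function w is a combination of dx, dy, du
    whose coefficients are regular up to a power of x; the pulled back
    coefficients express the differential of theta w. *)
Definition has_gradient (w : B) := exists k q1 q2 q3,
  [/\ q1 \in reg g, q2 \in reg g, q3 \in reg g,
    forall d, der_over_C d ->
      bX ^+ k * d w = q1 * d bX + q2 * d bY + q3 * d (bU m) &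
    forall d, der_over_C d ->
      theta bX ^+ k * d (theta w) =
      theta q1 * d (theta bX) + theta q2 * d (theta bY) + theta q3 * d (theta (bU m))].

Let Xr := reg_coordX g.
Let Yr := reg_coordY g.
Let Ur : bU m \in reg g. Proof. exact: reg_coordU. Qed.

Lemma cp_gradient z : coordinate_poly m z -> exists q1 q2 q3,
  [/\ q1 \in reg g, q2 \in reg g, q3 \in reg g,
    forall d, der_over_C d -> d z = q1 * d bX + q2 * d bY + q3 * d (bU m) &
    forall d, der_over_C d -> d (theta z) =
      theta q1 * d (theta bX) + theta q2 * d (theta bY) + theta q3 * d (theta (bU m))].
Proof.
have h0 := hom0 hom; have h1 := hom1 hom.
elim=> {z} [c||||v w Hv [q1 [q2 [q3 [R1 R2 R3 E E']]]] Hw [r1 [r2 [r3 [S1 S2 S3 G G']]]]|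
            v w Hv [q1 [q2 [q3 [R1 R2 R3 E E']]]] Hw [r1 [r2 [r3 [S1 S2 S3 G G']]]]].
- exists 0, 0, 0; rewrite rpred0 h0; split=> // d [dd dC]; first by rewrite dC; ring.
  by rewrite (homC hom) dC; ring.
- exists 1, 0, 0; rewrite rpred0 rpred1 h0 h1; split=> // d _; ring.
- exists 0, 1, 0; rewrite rpred0 rpred1 h0 h1; split=> // d _; ring.
- exists 0, 0, 1; rewrite rpred0 rpred1 h0 h1; split=> // d _; ring.
- exists (q1 + r1), (q2 + r2), (q3 + r3); rewrite !rpredD //; split=> // d Hd.
    by rewrite (derD Hd.1) (E d Hd) (G d Hd); ring.
  rewrite (homD hom) ?(cp_reg _ m_gt0 n_gt0) // (derD Hd.1) (E' d Hd) (G' d Hd).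
  by rewrite !(homD hom) //; ring.
have Rv := cp_reg p m_gt0 n_gt0 Hv; have Rw := cp_reg p m_gt0 n_gt0 Hw.
exists (q1 * w + v * r1), (q2 * w + v * r2), (q3 * w + v * r3).
rewrite !rpredD ?rpredM //; split=> // d Hd.
  by rewrite (derM Hd.1) (E d Hd) (G d Hd); ring.
rewrite (homM hom) // (derM Hd.1) (E' d Hd) (G' d Hd).
have hh q r : q \in reg g -> r \in reg g ->
    theta (q * w + v * r) = theta q * theta w + theta v * theta r.
  by move=> Hq Hr; rewrite (homD hom) ?rpredM // (homM hom) // (homM hom).
by rewrite !hh //; ring.
Qed.

Lemma reg_gradient w : w \in reg g -> has_gradient w.
Proof.
move=> Hw; have [k Hk] : exists k, coordinate_poly m (bX ^+ k * w).
  by apply: polyOver_cp; case/regP: Hw.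
have [q1 [q2 [q3 [R1 R2 R3 E E']]]] := cp_gradient Hk.
have dXn d (a : B) : derivation d -> d (a ^+ k) = k%:R * a ^+ k.-1 * d a.
  by move=> dd; case: (k) => [|j]; rewrite ?(derXn dd) // (der1 dd) !mul0r.
exists k, (q1 - k%:R * bX ^+ k.-1 * w), q2, q3.
have Rk : k%:R * bX ^+ k.-1 * w \in reg g by rewrite !(rpredM, rpred_nat, rpredX).
rewrite rpredB ?rpredM // ?rpred_nat ?rpredX //; split=> // d Hd.
  apply: (addrI (k%:R * bX ^+ k.-1 * d bX * w)).
  have := E d Hd; rewrite (derM Hd.1) (dXn _ _ Hd.1) => ->; ring.
apply: (addrI (k%:R * theta bX ^+ k.-1 * d (theta bX) * theta w)).
have := E' d Hd; rewrite (homM hom) ?rpredX // (homXn hom) // (derM Hd.1) (dXn _ _ Hd.1) => ->.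
have -> : theta (q1 - k%:R * bX ^+ k.-1 * w) =
    theta q1 - k%:R * theta bX ^+ k.-1 * theta w.
  rewrite (homD hom) ?rpredN // (homN hom) // (homM hom) ?(rpredM, rpred_nat, rpredX) //.
  rewrite (homM hom) ?(rpred_nat, rpredX) // (homXn hom) //.
  by congr (_ - _ * _ * _); rewrite -(rmorph_nat polyC) -(rmorph_nat cK) (homC hom).
ring.
Qed.

Hypothesis hX0 : theta bX != 0.

Lemma bracket_hom w1 w2 w3 : w1 \in reg g -> w2 \in reg g -> w3 \in reg g ->
  theta bX ^+ m * bracket (theta w1) (theta w2) (theta w3) =
  theta (bracket w1 w2 w3) * bracket (theta bX) (theta bY) (theta (bU m)).
Proof.
move=> H1 H2 H3.
have [k1 [a1 [a2 [a3 [A1 A2 A3 E1 E1']]]]] := reg_gradient H1.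
have [k2 [b1 [b2 [b3 [B1 B2 B3 E2 E2']]]]] := reg_gradient H2.
have [k3 [c1 [c2 [c3 [C1 C2 C3 E3 E3']]]]] := reg_gradient H3.
have F : bX ^+ k1 * bX ^+ k2 * bX ^+ k3 * bracket w1 w2 w3 =
    det3 a1 a2 a3 b1 b2 b3 c1 c2 c3 * bX ^+ m.
  rewrite -(bracket_XYU K m) /nambu.
  by apply: det3_mul; rewrite ?E1 ?E2 ?E3 //;
    first [exact: Dx_over_C|exact: Dy_over_C|exact: Dt_over_C].
have F' : theta bX ^+ k1 * theta bX ^+ k2 * theta bX ^+ k3 *
    bracket (theta w1) (theta w2) (theta w3) =
    theta (det3 a1 a2 a3 b1 b2 b3 c1 c2 c3) *
    bracket (theta bX) (theta bY) (theta (bU m)).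
  rewrite (hom_det3 hom) // /nambu.
  by apply: det3_mul; rewrite ?E1' ?E2' ?E3' //;
    first [exact: Dx_over_C|exact: Dy_over_C|exact: Dt_over_C].
have /(congr1 theta) := F.
have Rdet : det3 a1 a2 a3 b1 b2 b3 c1 c2 c3 \in reg g.
  by rewrite /det3 !(rpredD, rpredN, rpredM).
have Xk k : bX ^+ k \in reg g by rewrite rpredX.
have Rb := reg_bracket H1 H2 H3.
rewrite (homM hom _ Rb) ?rpredM // (homM hom Rdet (Xk m)) (homXn hom) //.
rewrite (homM hom _ (Xk k3)) ?rpredM // (homM hom (Xk k1) (Xk k2)) !(homXn hom) // => F''.
apply: (@mulfI _ (theta bX ^+ k1 * theta bX ^+ k2 * theta bX ^+ k3)).
  by rewrite !mulf_neq0 ?expf_neq0.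
rewrite mulrCA F' [RHS]mulrA F''; ring.
Qed.

Hypotheses (degx : forall j, (size (p`_j)%R <= m)%N) (degy : (size p <= n)%N).
Hypothesis p0 : p != 0.

(** The Jacobian determinant of theta is jU / theta(x)^m by bracket_hom, and also
    jV / theta(y)^n; as x^m and y^n generate the unit ideal, it is regular. *)
Lemma jacobian : exists2 J, J \in reg g' &
  forall w1 w2 w3, w1 \in reg g -> w2 \in reg g -> w3 \in reg g ->
    bracket (theta w1) (theta w2) (theta w3) = J * theta (bracket w1 w2 w3).
Proof.
have Vr : coordV K m n p \in reg g by exact: reg_coordV.
have [u [v [Hu Hv Euv]]] := unimodular K m_gt0 n_gt0 degx degy p0.
pose jU := bracket (theta bX) (theta bY) (theta (bU m)).
pose jV := bracket (theta bX) (theta bY) (theta (coordV K m n p)).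
exists (theta v * jU - theta u * jV).
  by rewrite rpredB // rpredM ?(reg_bracket, hom_reg hom).
move=> w1 w2 w3 H1 H2 H3.
have EV := bracket_hom Xr Yr Vr.
rewrite bracket_XYV (homXn hom) // -/jU -/jV in EV.
have E1 : theta bX ^+ m * theta v - theta bY ^+ n * theta u = 1.
  rewrite -(hom1 hom) -Euv (homD hom) ?rpredN ?rpredM ?rpredX // (homN hom) ?rpredM ?rpredX //.
  by rewrite !(homM hom) ?rpredX // !(homXn hom).
have Em : theta bX ^+ m * (theta v * jU - theta u * jV) = jU.
  transitivity ((theta bX ^+ m * theta v) * jU - theta u * (theta bX ^+ m * jV)); first by ring.
  by rewrite EV; transitivity ((theta bX ^+ m * theta v - theta bY ^+ n * theta u) * jU);
    [ring|rewrite E1 mul1r].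
apply: (@mulfI _ (theta bX ^+ m)); first by rewrite expf_neq0.
by rewrite bracket_hom // mulrA Em mulrC.
Qed.
End Jacobian.
End Transport.

(** * The residue is an invariant of the ring of regular functions *)

Section Invariance.
Variables (C : numFieldType) (K : diff_field C).
Local Notation emb := (df_emb K).
Local Notation xK := (fracX K).
Local Notation yK := (fracY K).
Local Notation cK := (fracC K).
Local Notation B := {poly K}.
Local Notation Sx := (@loc _ K (xP C)).
Local Notation Sy := (@loc _ K (yP C)).
Local Notation bX := (coordX K).
Local Notation bY := (coordY K).
Local Notation bU := (coordU K).
Local Notation Dx := (map_poly (@dx _ K)).
Local Notation Dy := (map_poly (@dy _ K)).
Local Notation bracket := (nambu (@dx _ K) (@dy _ K)).
Local Notation field := (vector_field (@dx _ K) (@dy _ K)).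
Let derx := @dx_derivation _ K.
Let dery := @dy_derivation _ K.
Let Derx := map_der_derivation derx.
Let Dery := map_der_derivation dery.
Let Dert := @deriv_derivation K.
Let xK0 := fracX_neq0 K.
Let yK0 := fracY_neq0 K.

(** Hartogs: a function on the punctured plane extends to the plane. *)
Lemma loc_xI_y j : j \in Sx -> j \in Sy -> exists P, j = emb P.
Proof.
move=> /locP[k [P HP]] /locP[l [Q HQ]].
have E : P * yP C ^+ l = Q * xP C ^+ k.
  apply: (@emb_inj _ K); rewrite !(rmorphM emb) -HP -HQ !(rmorphXn emb); ring.
exists (drop_poly l Q).
apply: (mulIf (expf_neq0 k xK0)); rewrite HP -(rmorphXn emb) -(rmorphM emb).
congr (emb _); apply/polyP => i; have := congr1 (fun R : {poly {poly C}} => R`_(i + l)) E.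
rewrite coefMXn ltnNge leq_addl addnK => /= ->.
by rewrite /xP -polyC_exp !coefMC coef_drop_poly.
Qed.

Lemma reg_unit g J J' : J \in reg g -> J' \in reg g -> J * J' = 1 ->
  exists c, J = (cK c)%:P.
Proof.
have const (w w' : B) : w \in reg g -> w * w' = 1 -> exists P, w = (emb P)%:P.
  move=> /regP[Hx Hy] ww'.
  have : w \is a GRing.unit by apply/unitrP; exists w'; rewrite mulrC.
  rewrite poly_unitE => /andP[/size_poly1P[j j0 Ej] _]; rewrite Ej shearC !polyOverC in Hx Hy *.
  by have [P ->] := loc_xI_y Hx Hy; exists P.
move=> HJ HJ' JJ'; have [P EP] := const _ _ HJ JJ'.
have [P' EP'] : exists P, J' = (emb P)%:P by apply: (const _ J) => //; rewrite mulrC.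
have PP' : P * P' = 1.
  apply: (@emb_inj _ K); rewrite (rmorphM emb) rmorph1; apply: (@polyC_inj K).
  by rewrite polyCM -EP -EP' JJ' polyC1.
have : P \is a GRing.unit by apply/unitrP; exists P'; rewrite mulrC.
rewrite poly_unitE => /andP[/size_poly1P[q q0 Eq]].
rewrite Eq coefC /= poly_unitE => /andP[/size_poly1P[c _ Ec] _].
by exists c; rewrite EP Eq Ec.
Qed.

Variables (m1 n1 m2 n2 : nat) (p1 p2 : {poly {poly C}}).
Hypotheses (m1_gt0 : (0 < m1)%N) (n1_gt0 : (0 < n1)%N).
Hypotheses (m2_gt0 : (0 < m2)%N) (n2_gt0 : (0 < n2)%N).
Hypotheses (degx1 : forall j, (size (p1`_j)%R <= m1)%N) (degy1 : (size p1 <= n1)%N).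
Hypotheses (degx2 : forall j, (size (p2`_j)%R <= m2)%N) (degy2 : (size p2 <= n2)%N).
Hypotheses (p1_neq0 : p1 != 0) (p2_neq0 : p2 != 0).
Local Notation g1 := (transition K m1 n1 p1).
Local Notation g2 := (transition K m2 n2 p2).

Variables theta theta' : B -> B.
Hypotheses (hom : alg_hom g2 g1 theta) (hom' : alg_hom g1 g2 theta').
Hypotheses (thetaK : forall w, w \in reg g2 -> theta' (theta w) = w).
Hypotheses (theta'K : forall w, w \in reg g1 -> theta (theta' w) = w).

(** An isomorphism multiplies the volume form by a unit, hence by a constant,
    and so transports fields of divergence one. *)
Theorem residue_invariant : p2`_n2.-1`_m2.-1 = 0 -> p1`_n1.-1`_m1.-1 = 0.
Proof.
move=> res2.
have bX0 : bX != 0 by rewrite polyC_eq0.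
have X1 := reg_coordX g1; have Y1 := reg_coordY g1; have U1 : bU m1 \in reg g1 by exact: reg_coordU.
have hX0 : theta bX != 0.
  apply: contraNneq bX0 => E; rewrite -(thetaK (reg_coordX g2)) E (hom0 hom'); exact/eqP.
have hX0' : theta' bX != 0.
  apply: contraNneq bX0 => E; rewrite -(theta'K X1) E (hom0 hom); exact/eqP.
have [J HJ EJ] := jacobian m2_gt0 n2_gt0 hom hX0 degx2 degy2 p2_neq0.
have [J' HJ' EJ'] := jacobian m1_gt0 n1_gt0 hom' hX0' degx1 degy1 p1_neq0.
(* The chain rule makes the Jacobian determinant of theta' an inverse of J. *)
have [j Ej] : exists j, J = (cK j)%:P.
  apply: (reg_unit HJ (hom_reg hom HJ')).
  apply: (mulIf (expf_neq0 m1 bX0)); rewrite mul1r -[in RHS](bracket_XYU K m1).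
  rewrite -{2}(theta'K X1) -{1}(theta'K Y1) -{1}(theta'K U1).
  rewrite EJ ?(hom_reg hom') // EJ' // (homM hom) ?(hom_reg hom') ?reg_bracket //.
  by rewrite theta'K ?reg_bracket // bracket_XYU mulrA.
have [a [b [c [Rabc dv]]]] := divergence1_field K m2_gt0 n2_gt0 degx2 degy2 p2_neq0 res2.
(* D turns out to be the field with components a1, b1, c1. *)
pose D w := theta (field a b c (theta' w)).
have Rf w : w \in reg g1 -> field a b c (theta' w) \in reg g2.
  by move=> Hw; apply: reg_field => //; exact: (hom_reg hom').
have [Fd Fm] := field_derivation derx dery a b c.
have Dr w : w \in reg g1 -> D w \in reg g1 by move=> Hw; rewrite (hom_reg hom) ?Rf.
have DD v w : v \in reg g1 -> w \in reg g1 -> D (v + w) = D v + D w.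
  by move=> Hv Hw; rewrite /D (homD hom') // Fd (homD hom) ?Rf.
have DM v w : v \in reg g1 -> w \in reg g1 -> D (v * w) = D v * w + v * D w.
  move=> Hv Hw; rewrite /D (homM hom') // Fm.
  by rewrite (homD hom) ?rpredM ?Rf ?(hom_reg hom') // !(homM hom) ?Rf ?(hom_reg hom') // !theta'K.
have DC e : D (cK e)%:P = 0.
  rewrite /D (homC hom') /vector_field (map_derC derx) (map_derC dery) derivC dx_c dy_c polyC0.
  by rewrite !mulr0 !addr0 (hom0 hom).
pose a1 := D bX; pose b1 := D bY.
pose c1 := (xK ^+ m1)^-1%:P * (D (bU m1) - m1%:R * bX ^+ m1.-1 * a1 * 'X).
have XV : bX ^+ m1 * (xK ^+ m1)^-1%:P = 1.
  by rewrite /coordX -polyC_exp -polyCM divff ?expf_neq0.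
have cX : field a1 b1 c1 bX = a1.
  by rewrite /vector_field /coordX (map_derC derx) (map_derC dery) derivC dx_x dy_x polyC1 polyC0; ring.
have cY : field a1 b1 c1 bY = b1.
  by rewrite /vector_field /coordY (map_derC derx) (map_derC dery) derivC dx_y dy_y polyC1 polyC0; ring.
have dXm : Dx (bX ^+ m1) = m1%:R * bX ^+ m1.-1.
  case: (m1) => [|k]; first by rewrite expr0 (der1 Derx) mul0r.
  by rewrite (derXn Derx) (map_derC derx) dx_x polyC1 mulr1.
have dyX : Dy (bX ^+ m1) = 0.
  by rewrite /coordX -polyC_exp (map_derC dery) (der_cst_Xn _ dery (dy_x K)) polyC0.
have dtX : (bX ^+ m1)^`() = 0 by rewrite /coordX -polyC_exp derivC.
have cU : field a1 b1 c1 (bU m1) = D (bU m1).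
  rewrite /vector_field [X in Dx X]/coordU [X in Dy X]/coordU [X in X^`()]/coordU.
  rewrite (derM Derx) (derM Dery) derivM derivX dXm dyX dtX.
  rewrite (map_derX derx) (map_derX dery) /c1.
  transitivity (m1%:R * bX ^+ m1.-1 * a1 * 'X +
    bX ^+ m1 * (xK ^+ m1)^-1%:P * (D (bU m1) - m1%:R * bX ^+ m1.-1 * a1 * 'X)); first by ring.
  by rewrite XV; ring.
have Df := field_unique m1_gt0 n1_gt0 DD DM DC (esym cX) (esym cY) (esym cU).
have V1 : coordV K m1 n1 p1 \in reg g1 by exact: reg_coordV.
have Rabc1 : regular_field g1 a1 b1 c1.
  have Ra : a1 \in reg g1 by exact: Dr.
  have Rb : b1 \in reg g1 by exact: Dr.
  split=> //.
    have RU := Dr _ U1; case/regP: RU => RU _; case/regP: Ra => Ra _.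
    by rewrite rpredM ?polyOver_invx // rpredB // !rpredM ?rpredX ?polyOverX ?polyOver_embC ?rpred_nat.
  have RV : shear g1 (field a1 b1 c1 (coordV K m1 n1 p1)) \is a polyOver Sy.
    by rewrite -Df //; have /regP[] := Dr _ V1.
  have dYn : Dy (bY ^+ n1) = n1%:R * bY ^+ n1.-1.
    case: (n1) => [|k]; first by rewrite expr0 (der1 Dery) mul0r.
    by rewrite (derXn Dery) (map_derC dery) dy_y polyC1 mulr1.
  have dxY : Dx (bY ^+ n1) = 0.
    by rewrite /coordY -polyC_exp (map_derC derx) (der_cst_Xn _ derx (dx_y K)) polyC0.
  have dtY : (bY ^+ n1)^`() = 0 by rewrite /coordY -polyC_exp derivC.
  have YV : bY ^+ n1 * (yK ^+ n1)^-1%:P = 1.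
    by rewrite /coordY -polyC_exp -polyCM divff ?expf_neq0.
  have -> : c1 + a1 * (dx g1)%:P + b1 * (dy g1)%:P =
      (yK ^+ n1)^-1%:P * (field a1 b1 c1 (coordV K m1 n1 p1)
        - n1%:R * bY ^+ n1.-1 * b1 * ('X + g1%:P)).
    rewrite /vector_field /coordV (derM Derx) (derM Dery) derivM dYn dxY dtY.
    rewrite (derD Derx) (derD Dery) derivD derivX derivC.
    rewrite (map_derX derx) (map_derX dery) !(map_derC derx) !(map_derC dery).
    transitivity (bY ^+ n1 * (yK ^+ n1)^-1%:P * (c1 + a1 * (dx g1)%:P + b1 * (dy g1)%:P)).
      by rewrite YV mul1r.
    by ring.
  rewrite rmorphM rmorphB /= shearC rpredM ?polyOver_invy // rpredB //.
  have shT : shear g1 ('X + g1%:P) = 'X by rewrite rmorphD /= shearX shearC subrK.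
  have -> : shear g1 (n1%:R * bY ^+ n1.-1 * b1 * ('X + g1%:P)) =
      n1%:R * bY ^+ n1.-1 * shear g1 b1 * 'X.
    by rewrite (rmorphM (shear g1)) /= shT !(rmorphM (shear g1)) rmorph_nat rmorphXn /= shearC.
  case/regP: Rb => _ Rb.
  by rewrite !rpredM ?rpred_nat ?rpredX ?polyOverX ?polyOver_embC.
apply: (divergence1_coef m1_gt0 n1_gt0 Rabc1).
have lie := bracket_field derx dery (@dxy_comm _ K) a1 b1 c1 bX bY (bU m1).
rewrite /= cX cY cU in lie.
have lie2 u1 u2 u3 : u1 \in reg g2 -> u2 \in reg g2 -> u3 \in reg g2 ->
    bracket (theta (field a b c u1)) (theta u2) (theta u3) +
    bracket (theta u1) (theta (field a b c u2)) (theta u3) +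
    bracket (theta u1) (theta u2) (theta (field a b c u3)) =
    J * theta (field a b c (bracket u1 u2 u3)) + J * theta (bracket u1 u2 u3).
  move=> H1 H2 H3; have Rfu u : u \in reg g2 -> field a b c u \in reg g2 by exact: reg_field.
  rewrite !EJ ?Rfu // -!mulrDr; congr (J * _).
  have R1 := reg_bracket (Rfu _ H1) H2 H3; have R2 := reg_bracket H1 (Rfu _ H2) H3.
  have R3 := reg_bracket H1 H2 (Rfu _ H3); have R4 := reg_bracket H1 H2 H3.
  rewrite -(homD hom R1 R2) -(homD hom (rpredD R1 R2) R3) -(homD hom (Rfu _ R4) R4).
  by rewrite (bracket_field derx dery (@dxy_comm _ K)) dv mul1r.
have lie' : bracket a1 bY (bU m1) + bracket bX b1 (bU m1) + bracket bX bY (D (bU m1))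
    = D (bracket bX bY (bU m1)) + bracket bX bY (bU m1).
  have := lie2 _ _ _ (hom_reg hom' X1) (hom_reg hom' Y1) (hom_reg hom' U1).
  rewrite -!/(D _) !theta'K // => ->.
  have EB : bracket bX bY (bU m1) = J * theta (bracket (theta' bX) (theta' bY) (theta' (bU m1))).
    by rewrite -EJ ?(hom_reg hom') // !theta'K.
  have RB : bracket (theta' bX) (theta' bY) (theta' (bU m1)) \in reg g2.
    by rewrite reg_bracket ?(hom_reg hom').
  have DJ : D J = 0 by rewrite Ej DC.
  rewrite EB DM ?(hom_reg hom) // DJ mul0r add0r; congr (_ * _ + _).
  by rewrite /D thetaK.
apply: (mulIf (expf_neq0 m1 bX0)); rewrite mul1r -(bracket_XYU K m1).
apply: (addrI (D (bracket bX bY (bU m1)))).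
by rewrite -lie' lie Df ?reg_bracket.
Qed.
End Invariance.

(** * Regular functions on principal open sets *)

Lemma mpoly_ring_ind (R : comNzRingType) n (Q : {mpoly R[n]} -> Prop) :
  (forall c, Q c%:MP) -> (forall i, Q 'X_i) ->
  (forall p q, Q p -> Q q -> Q (p + q)) -> (forall p q, Q p -> Q q -> Q (p * q)) ->
  forall p, Q p.
Proof.
move=> QC QX QD QM p; rewrite (mpolyE p).
elim/big_ind: _ => [|//|m _]; first by rewrite -mpolyC0.
rewrite -mul_mpolyC; apply: (QM) => //; rewrite mpolyXE_id.
elim/big_ind: _ => [|//|i _]; first by rewrite -mpolyC1.
by elim: (m i) => [|k IH]; rewrite ?expr0 -?mpolyC1 // exprS; exact: QM.
Qed.

Lemma poly_eq0_nat (R : idomainType) (P : {poly R}) :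
  (forall k, k.+1%:R != 0 :> R) -> (forall k : nat, P.[k.+1%:R] = 0) -> P = 0.
Proof.
move=> char0 H; apply/eqP; apply: contraT => P0.
pose s := [seq k.+1%:R | k <- iota 0 (size P)] : seq R.
have inj i j : (i < j)%N -> i.+1%:R != j.+1%:R :> R.
  move=> ij; rewrite eq_sym -subr_eq0 -natrB ?ltnS ?(ltnW ij) // subSS.
  by rewrite -(prednK (n := (j - i)%N)) ?subn_gt0.
have us : uniq s.
  rewrite map_inj_uniq ?iota_uniq // => i j /eqP.
  by case: (ltngtP i j) => // /inj; [|rewrite eq_sym] => /negPf ->.
have := max_poly_roots P0 _ us; rewrite size_map size_iota ltnn => -> //.
by apply/allP => z /mapP[k _ ->]; apply/rootP.
Qed.

Section Regular.
Variable C : numClosedFieldType.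

Lemma no_root_dvd (b : bool) (h : {poly C}) K : h != 0 -> (size h <= K)%N ->
  (forall s, b ==> (s != 0) -> h.[s] != 0) -> h %| (if b then 'X else 1) ^+ K.
Proof.
move=> h0 hK H; have [rs E] := closed_field_poly_normal h.
have l0 : lead_coef h != 0 by rewrite lead_coef_eq0.
have rs0 z : z \in rs -> b /\ z = 0.
  move=> zrs; have rz : h.[z] = 0.
    rewrite E hornerZ; have /rootP -> : root (\prod_(z <- rs) ('X - z%:P)) z.
      by rewrite root_prod_XsubC.
    by rewrite mulr0.
  have := H z; rewrite rz eqxx; case: (b) => /=; last by move=> /(_ isT).
  by case: (eqVneq z 0) => [->|_ /(_ isT)].
have Ers : \prod_(z <- rs) ('X - z%:P) = 'X^(size rs) :> {poly C}.
  rewrite big_seq (eq_bigr (fun=> 'X)) => [|z /rs0[_ ->]]; last by rewrite subr0.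
  by rewrite -big_seq big_const_seq count_predT iter_mulr_1.
have srs : (size rs <= K)%N.
  apply: leq_trans hK; rewrite E size_scale // Ers size_polyXn; exact: leqnSn.
rewrite E dvdpZl // Ers; case: rs rs0 srs {E Ers} => [|z rs] rs0 srs.
  by rewrite expr0 dvd1p.
by have [-> _] := rs0 z (mem_head _ _); rewrite dvdp_exp2l.
Qed.

(** In one variable, a fraction in lowest terms that agrees with f has no pole
    where f is regular. *)
Lemma regular_univariate (b : bool) (f : C -> C) (g0 h0 : {poly C}) K :
  h0 != 0 -> (size h0 <= K)%N ->
  (forall s : C, b ==> (s != 0) -> f s * h0.[s] = g0.[s]) ->
  (forall s : C, b ==> (s != 0) -> exists g h : {poly C}, h.[s] != 0 /\
     forall s' : C, b ==> (s' != 0) -> f s' * h.[s'] = g.[s']) ->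
  exists P : {poly C}, (size P <= size g0 + K)%N /\
    forall s : C, b ==> (s != 0) -> f s * (if b then s else 1) ^+ K = P.[s].
Proof.
move=> h00 hK fh loc; pose U (s : C) := b ==> (s != 0).
pose d := gcdp g0 h0; have d0 : d != 0 by rewrite gcdp_eq0 negb_and h00 orbT.
pose g := g0 %/ d; pose h := h0 %/ d.
have Eg : g0 = g * d by rewrite divpK // dvdp_gcdl.
have Eh : h0 = h * d by rewrite divpK // dvdp_gcdr.
have h_neq0 : h != 0 by apply: contraNneq h00 => E; rewrite Eh E mul0r.
have cop : coprimep g h by rewrite coprimep_div_gcd // h00 orbT.
have Unat k : U (k.+1%:R : C) by rewrite /U pnatr_eq0 implybT.
have agree (G H : {poly C}) : (forall s', U s' -> f s' * H.[s'] = G.[s']) -> G * h = g * H.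
  move=> E; apply: (mulIf d0); rewrite -mulrA -Eh mulrAC -Eg.
  apply/eqP; rewrite -subr_eq0; apply/eqP/poly_eq0_nat => k; first by rewrite pnatr_eq0.
  by rewrite hornerD hornerN !hornerM -(E _ (Unat k)) -(fh _ (Unat k)); ring.
have hU s : U s -> h.[s] != 0.
  move=> Us; have [G [H [Hs E]]] := loc s Us.
  have hH : h %| H.
    by rewrite -(Gauss_dvdpr _ (_ : coprimep h g)) 1?coprimep_sym // -(agree G H E) dvdp_mull.
  by apply: contraNneq Hs => hs0; rewrite -(divpK hH) hornerM hs0 mulr0.
have hr : h %| (if b then 'X else 1) ^+ K.
  apply: no_root_dvd => //; apply: leq_trans hK; rewrite Eh size_mul //.
  by rewrite -subn1 -addnBA ?leq_addr // size_poly_gt0.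
pose e := (if b then 'X else 1) ^+ K %/ h.
have Er : (if b then 'X else 1) ^+ K = e * h :> {poly C} by rewrite divpK.
have fhs s : U s -> f s * h.[s] = g.[s].
  move=> Us; have [G [H [Hs E]]] := loc s Us; apply: (mulIf Hs).
  rewrite mulrAC E // -!hornerM; by rewrite (agree G H).
exists (g * e); split.
  have r0 : (if b then 'X else 1) ^+ K != 0 :> {poly C}.
    by rewrite expf_neq0 //; case: (b); rewrite ?polyX_eq0 ?oner_eq0.
  have sr : (size ((if b then 'X else 1 : {poly C}) ^+ K)%R <= K.+1)%N.
    by case: (b); rewrite ?size_polyXn // expr1n size_poly1.
  have se : (size e <= K.+1)%N.
    by apply: leq_trans sr; apply: dvdp_leq => //; rewrite Er dvdp_mulr.
  have sg : (size g <= size g0)%N by rewrite leq_divp.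
  apply: leq_trans (size_polyMleq _ _) _; have := leq_add sg se; rewrite addnS.
  by case: (_ + size e)%N.
move=> s Us; have := congr1 (horner^~ s) Er; rewrite horner_exp hornerM.
have -> : (if b then 'X else 1).[s] = if b then s else 1.
  by case: (b); rewrite hornerE.
by move=> ->; rewrite hornerM -fhs //; ring.
Qed.

End Regular.

Section PrincipalOpen.
Variables (C : numClosedFieldType) (n : nat).
Implicit Types (q g h : {mpoly C[n]}) (a b : affine C n) (f : affine C n -> C).

Definition upd a (i : 'I_n) (s : C) : affine C n := fun j => if j == i then s else a j.

Lemma upd_eq a i s : upd a i s i = s. Proof. by rewrite /upd eqxx. Qed.
Lemma upd_id a i : upd a i (a i) = a.
Proof. by apply/funext => j; rewrite /upd; case: eqP => // ->. Qed.

Lemma meval_slice q i : exists d, forall a, exists P : {poly C},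
  (size P <= d)%N /\ forall s, q.@[upd a i s] = P.[s].
Proof.
elim/mpoly_ring_ind: q => [c|j|p q [d Hd] [e He]|p q [d Hd] [e He]].
- exists 1%N => a; exists c%:P; rewrite size_polyC_leq1; split=> // s.
  by rewrite mevalC hornerC.
- exists 2%N => a; have [->|ne] := eqVneq j i.
    exists 'X; rewrite size_polyX; split=> // s; by rewrite mevalXU upd_eq hornerX.
  exists (a j)%:P; rewrite (leq_trans (size_polyC_leq1 _)) //; split=> // s.
  by rewrite mevalXU /upd (negPf ne) hornerC.
- exists (maxn d e) => a; have [P [sP EP]] := Hd a; have [Q [sQ EQ]] := He a.
  exists (P + Q); split; last by move=> s; rewrite mevalD EP EQ hornerD.
  by rewrite (leq_trans (size_polyD _ _)) // geq_max !leq_max sP sQ orbT.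
- exists (d + e)%N => a; have [P [sP EP]] := Hd a; have [Q [sQ EQ]] := He a.
  exists (P * Q); split; last by move=> s; rewrite mevalM EP EQ hornerM.
  by rewrite (leq_trans (size_polyMleq _ _)) // (leq_trans (leq_pred _)) // leq_add.
Qed.

Lemma meval_subst q i c : exists q', forall a, q'.@[a] = q.@[upd a i c].
Proof.
elim/mpoly_ring_ind: q => [e|j|p q [p' Hp] [q' Hq]|p q [p' Hp] [q' Hq]].
- by exists e%:MP => a; rewrite !mevalC.
- have [->|ne] := eqVneq j i; [exists c%:MP => a|exists 'X_j => a].
    by rewrite mevalC mevalXU upd_eq.
  by rewrite !mevalXU /upd (negPf ne).
- by exists (p' + q') => a; rewrite !mevalD Hp Hq.
- by exists (p' * q') => a; rewrite !mevalM Hp Hq.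
Qed.

Lemma meval_line q a b : exists P : {poly C},
  forall s, q.@[fun i => a i + s * (b i - a i)] = P.[s].
Proof.
elim/mpoly_ring_ind: q => [e|j|p q [p' Hp] [q' Hq]|p q [p' Hp] [q' Hq]].
- by exists e%:P => s; rewrite mevalC hornerC.
- by exists ((a j)%:P + 'X * (b j - a j)%:P) => s; rewrite mevalXU !hornerE.
- by exists (p' + q') => s; rewrite mevalD Hp Hq hornerD.
- by exists (p' * q') => s; rewrite mevalM Hp Hq hornerM.
Qed.

Variable i0 : 'I_n.
Local Notation D a := (a i0 != 0).

(** Irreducibility of x_i0 <> 0, seen on the line through a and b, where a product
    of nonzero polynomials in one variable has a nonzero value. *)
Lemma principal_irreducible g h a b : D a -> D b -> g.@[a] != 0 -> h.@[b] != 0 ->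
  exists2 c, D c & (g.@[c] != 0) && (h.@[c] != 0).
Proof.
move=> Da Db ga hb; pose l s : affine C n := fun i => a i + s * (b i - a i).
have l0 : l 0 = a by apply/funext => i; rewrite /l mul0r addr0.
have l1 : l 1 = b by apply/funext => i; rewrite /l mul1r addrC subrK.
have [G HG] := meval_line g a b; have [H HH] := meval_line h a b.
have [X HX] := meval_line 'X_i0 a b.
have nz P (s : C) : P.[s] != 0 -> P != 0 by apply: contraNneq => ->; rewrite horner0.
have : G * H * X != 0.
  rewrite !mulf_neq0 //; first by apply: (nz _ 0); rewrite -HG -/(l 0) l0.
    by apply: (nz _ 1); rewrite -HH -/(l 1) l1.
  by apply: (nz _ 0); rewrite -HX -/(l 0) l0 mevalXU.
move=> GHX; have /existsNP[k /eqP] : ~ forall k : nat, (G * H * X).[k.+1%:R] = 0.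
  move/poly_eq0_nat => E; rewrite E ?eqxx // in GHX => k; by rewrite pnatr_eq0.
rewrite !hornerM !mulf_eq0 !negb_or -HG -HH -HX mevalXU -andbA => /and3P[gc hc xc].
by exists (l k.+1%:R) => //; rewrite gc hc.
Qed.

(** Regularity in the form given by regular_denominator below: each denominator h,
    nonzero at a, clears f at all points. *)
Definition loc_fraction f := forall a, D a ->
  exists g h, h.@[a] != 0 /\ forall b, D b -> f b * h.@[b] = g.@[b].

Lemma lf_poly q : loc_fraction (fun a => q.@[a]).
Proof. by move=> a _; exists q, 1; rewrite meval1 oner_eq0; split=> // b _; rewrite meval1 mulr1. Qed.

Lemma lf_add f1 f2 : loc_fraction f1 -> loc_fraction f2 ->
  loc_fraction (fun a => f1 a + f2 a).
Proof.
move=> H1 H2 a Da; have [g1 [h1 [n1 E1]]] := H1 a Da; have [g2 [h2 [n2 E2]]] := H2 a Da.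
exists (g1 * h2 + g2 * h1), (h1 * h2); rewrite mevalM mulf_neq0 //; split=> // b Db.
by rewrite !(mevalM, mevalD) -E1 // -E2 //; ring.
Qed.

Lemma lf_mul f1 f2 : loc_fraction f1 -> loc_fraction f2 ->
  loc_fraction (fun a => f1 a * f2 a).
Proof.
move=> H1 H2 a Da; have [g1 [h1 [n1 E1]]] := H1 a Da; have [g2 [h2 [n2 E2]]] := H2 a Da.
exists (g1 * g2), (h1 * h2); rewrite mevalM mulf_neq0 //; split=> // b Db.
by rewrite !mevalM -E1 // -E2 //; ring.
Qed.

Lemma lf_sum d (F : 'I_d -> affine C n -> C) : (forall j, loc_fraction (F j)) ->
  loc_fraction (fun a => \sum_(j < d) F j a).
Proof.
move=> H; elim: d F H => [|d IH] F H.
  have -> : (fun a => \sum_(j < 0) F j a) = (fun a => (0 : {mpoly C[n]}).@[a]).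
    by apply/funext => a; rewrite big_ord0 meval0.
  exact: lf_poly.
have -> : (fun a => \sum_(j < d.+1) F j a) =
    (fun a => \sum_(j < d) F (widen_ord (leqnSn d) j) a + F ord_max a).
  by apply/funext => a; rewrite big_ord_recr.
by apply: lf_add => //; apply: IH => j.
Qed.

Lemma upd_D a i s : D a -> (i == i0) ==> (s != 0) -> D (upd a i s).
Proof. by rewrite /upd [i == i0]eq_sym => Da; case: (i0 == i). Qed.

Lemma lf_upd f i c : (i == i0) ==> (c != 0) -> loc_fraction f ->
  loc_fraction (fun a => f (upd a i c)).
Proof.
move=> Hc H a Da; have [g [h [n0 E]]] := H _ (upd_D Da Hc).
have [g' Hg] := meval_subst g i c; have [h' Hh] := meval_subst h i c.
by exists g', h'; rewrite Hh; split=> // b Db; rewrite Hh Hg E // upd_D.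
Qed.

Lemma lf_eq0 f q a0 : loc_fraction f -> D a0 -> q.@[a0] != 0 ->
  (forall a, D a -> f a * q.@[a] = 0) -> forall a, D a -> f a = 0.
Proof.
move=> lf Da0 qa0 fq a Da; apply/eqP; apply: contraT => fa.
have [g [h [ha E]]] := lf a Da.
have ga : g.@[a] != 0 by rewrite -E // mulf_neq0.
have [c Dc /andP[gc qc]] := principal_irreducible Da Da0 ga qa0.
have := fq c Dc => /eqP; rewrite mulf_eq0 (negPf qc) orbF => /eqP fc0.
by move: gc; rewrite -E // fc0 mul0r eqxx.
Qed.

(* Sampling points: nonzero, because x_i0 must not vanish. *)
Let pt (k : nat) : C := k.+1%:R.
Let pt_inj : injective pt.
Proof. by move=> i j /eqP; rewrite /pt eqr_nat => /eqP[]. Qed.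
Let pw i (K : nat) (s : C) : C := if i == i0 then s ^+ K else 1.

(** Interpolation in the variable i: by the univariate case the restrictions of
    f to lines are polynomials of bounded degree, up to a power of x_i0. *)
Lemma lf_interpolate f i : loc_fraction f -> exists K d,
  forall a, D a -> pw i K (a i) * f a =
    \sum_(j < d) pw i K (pt j) * f (upd a i (pt j)) * (tnth (lagrange d pt) j : {poly C}).[a i].
Proof.
move=> lf; pose one : affine C n := fun=> 1.
have D1 : D one by rewrite /one oner_eq0.
have [g0 [h0 [h01 E0]]] := lf one D1.
have [dg Hg] := meval_slice g0 i; have [K Hh] := meval_slice h0 i.
exists K, (dg + K).+1 => a Da.
have ptU j : (i == i0) ==> (pt j != 0) by rewrite pnatr_eq0 implybT.
have [q Hq] := meval_subst h0 i 1.
(* E is the interpolation error.  It vanishes at b if h0 is not zero on the whole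
   line through b in direction i, in particular if q is not zero at b; by density
   it vanishes everywhere. *)
pose E b := pw i K (b i) * f b + - \sum_(j < (dg + K).+1)
  pw i K (pt j) * f (upd b i (pt j)) * (tnth (lagrange (dg + K).+1 pt) j : {poly C}).[b i].
suff : forall b, D b -> E b = 0 by move=> /(_ a Da) /eqP; rewrite subr_eq0 => /eqP.
have lfX : loc_fraction (fun b => pw i K (b i)).
  rewrite /pw; case: (i == i0).
    rewrite (_ : (fun _ => _) = (fun b => ('X_i ^+ K : {mpoly C[n]}).@[b])); first exact: lf_poly.
    by apply/funext => b; rewrite rmorphXn /= mevalXU.
  rewrite (_ : (fun _ => _) = (fun b => (1 : {mpoly C[n]}).@[b])); first exact: lf_poly.
  by apply/funext => b; rewrite meval1.
have lfP (P : {poly C}) : loc_fraction (fun b => P.[b i]).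
  elim/poly_ind: P => [|P c IH].
    rewrite (_ : (fun _ => _) = (fun b => (0 : {mpoly C[n]}).@[b])); first exact: lf_poly.
    by apply/funext => b; rewrite meval0 horner0.
  rewrite (_ : (fun _ => _) = (fun b => P.[b i] * ('X_i : {mpoly C[n]}).@[b] + (c%:MP : {mpoly C[n]}).@[b])).
    by apply: lf_add; [apply: lf_mul|]; try exact: lf_poly.
  by apply/funext => b; rewrite mevalXU mevalC !hornerE.
have lfC (c : C) : loc_fraction (fun=> c).
  rewrite (_ : (fun _ => _) = (fun b => (c%:MP : {mpoly C[n]}).@[b])); first exact: lf_poly.
  by apply/funext => b; rewrite mevalC.
apply: (@lf_eq0 _ q one) => //.
- apply: lf_add; first exact: lf_mul.
  rewrite (_ : (fun _ => _) = (fun b => -1 * \sum_(j < (dg + K).+1)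
    pw i K (pt j) * f (upd b i (pt j)) * (tnth (lagrange (dg + K).+1 pt) j : {poly C}).[b i])).
    apply: lf_mul => //; apply: lf_sum => j; apply: lf_mul => //; apply: lf_mul => //.
    exact: lf_upd.
  by apply/funext => b; rewrite mulN1r.
- by rewrite Hq upd_id.
move=> b Db; rewrite Hq.
have [->|hb] := eqVneq (h0.@[upd b i 1]) 0; first by rewrite mulr0.
suff -> : E b = 0 by rewrite mul0r.
have [G [sG EG]] := Hg b; have [H [sH EH]] := Hh b.
have H0 : H != 0 by apply: contraNneq hb => HE; rewrite EH HE horner0.
have [|s Us|P [sP EP]] := @regular_univariate _ (i == i0) (fun s => f (upd b i s)) G H K H0 sH.
- by move=> s Us; rewrite -EH -EG E0 // upd_D.
- have [g [h [hs Eh]]] := lf _ (upd_D Db Us).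
  have [dg' Hg'] := meval_slice g i; have [dh' Hh'] := meval_slice h i.
  have [G' [_ EG']] := Hg' b; have [H' [_ EH']] := Hh' b.
  by exists G', H'; rewrite -EH'; split=> // s' Us'; rewrite -EH' -EG' Eh // upd_D.
have EP' s : (i == i0) ==> (s != 0) -> pw i K s * f (upd b i s) = P.[s].
  by move=> Us; rewrite -EP // mulrC /pw; case: (i == i0); rewrite ?expr1n.
have Ub : (i == i0) ==> (b i != 0) by apply/implyP => /eqP ->.
apply/eqP; rewrite /E subr_eq0 -{2}(upd_id b i) EP' //.
have sP' : (size P <= (dg + K).+1)%N by apply: (leq_trans sP); rewrite leqW // leq_add2r.
rewrite {1}(lagrange_gen (n := (dg + K).+1) _ pt_inj sP') // horner_sum; apply/eqP.
by apply: eq_bigr => j _; rewrite hornerM hornerC EP'.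
Qed.

Lemma meval_poly (P : {poly C}) i : exists q, forall a, q.@[a] = P.[a i].
Proof.
elim/poly_ind: P => [|P c [q Hq]]; first by exists 0 => a; rewrite meval0 horner0.
by exists (q * 'X_i + c%:MP) => a; rewrite mevalD mevalM mevalXU mevalC Hq !hornerE.
Qed.

(** Induction on the number of variables on which f depends: interpolation
    expresses f through functions of one variable less. *)
Theorem regular_principal_open f : loc_fraction f ->
  exists K q, forall a, D a -> f a * a i0 ^+ K = q.@[a].
Proof.
suff H k : (k <= n)%N -> forall f, loc_fraction f ->
    (forall a b, D a -> D b -> (forall j : 'I_n, (j < k)%N -> a j = b j) -> f a = f b) ->
    exists K q, forall a, D a -> f a * a i0 ^+ K = q.@[a].
  move=> lf; apply: (H n) => // a b _ _ E; congr f; apply/funext => j; exact: E.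
elim: k => [|k IH] kn {}f lf dep.
  pose one : affine C n := fun=> 1.
  exists 0%N, (f one)%:MP => a Da; rewrite expr0 mulr1 mevalC.
  by apply: dep => //; rewrite oner_eq0.
pose i := Ordinal kn; have [K [d E]] := lf_interpolate i lf.
have ptU j : (i == i0) ==> (pt j != 0) by rewrite pnatr_eq0 implybT.
have /choice[F HF] : forall j : 'I_d, exists Kq : nat * {mpoly C[n]},
    forall a, D a -> f (upd a i (pt j)) * a i0 ^+ Kq.1 = Kq.2.@[a].
  move=> j; have [||K' [q Hq]] := IH (ltnW kn) (fun a => f (upd a i (pt j))).
  - exact: lf_upd.
  - move=> a b Da Db Eab; apply: dep; rewrite ?upd_D // => l lk; rewrite /upd.
    case: eqP => // ne; apply: Eab; rewrite ltn_neqAle -ltnS lk andbT.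
    by apply/eqP => El; apply: ne; apply/val_inj.
  - by exists (K', q).
have /choice[L HL] : forall j : 'I_d, exists q, forall a : affine C n,
    q.@[a] = (tnth (lagrange d pt) j : {poly C}).[a i] by move=> j; exact: meval_poly.
pose M := (\max_(j < d) (F j).1)%N.
exists ((if i == i0 then K else 0) + M)%N.
exists (\sum_(j < d) (pw i K (pt j))%:MP * (F j).2 * 'X_i0 ^+ (M - (F j).1) * L j) => a Da.
rewrite exprD mulrA.
have -> : f a * a i0 ^+ (if i == i0 then K else 0%N) = pw i K (a i) * f a.
  by rewrite /pw; case: eqP => [->|_]; rewrite ?expr0 ?mulr1 ?mul1r // mulrC.
rewrite E // mulr_suml raddf_sum /=; apply: eq_bigr => j _.
rewrite !mevalM mevalC rmorphXn /= mevalXU HL -HF //.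
have -> : a i0 ^+ M = a i0 ^+ (F j).1 * a i0 ^+ (M - (F j).1).
  by rewrite -exprD subnKC // (leq_bigmax j).
ring.
Qed.
End PrincipalOpen.

(** * Regular functions in charts *)

(** A fraction that represents f near a can be multiplied by a function cutting
    out the neighbourhood, after which it clears f everywhere. *)
Lemma regular_denominator (C : fieldType) n (X : set (affine C n)) f : regular_on X f ->
  forall a, X a -> exists g h : {mpoly C[n]},
    h.@[a] != 0 /\ forall b, X b -> f b * h.@[b] = g.@[b].
Proof.
move=> reg a Xa; have [V [g [h [[S EV] Va E]]]] := reg a Xa; subst V.
case: Va => _ nz; have [q Sq qa] : exists2 q, S q & q.@[a] != 0.
  have /existsNP[q /not_implyP[Sq /eqP qa]] := nz; by exists q.
have [ha _] := E a (conj Xa nz).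
exists (g * q), (h * q); rewrite mevalM mulf_neq0 //; split=> // b Xb.
rewrite !mevalM; have [->|qb] := eqVneq q.@[b] 0; first by rewrite !mulr0.
have [hb ->] : h.@[b] != 0 /\ f b = g.@[b] / h.@[b].
  by apply: E; split=> // Z; move: qb; rewrite Z ?eqxx.
by rewrite mulrA divfK.
Qed.

Section Chart.
Variables (C : numClosedFieldType) (n k : nat) (X : set (affine C n)).
Variables (i0 : 'I_n) (j0 : 'I_k) (pt : affine C k -> affine C n) (co : affine C n -> affine C k).
Hypothesis pt_poly : forall i, exists N (q : {mpoly C[k]}),
  forall c, c j0 != 0 -> pt c i * c j0 ^+ N = q.@[c].
Hypothesis co_poly : forall j, exists N (q : {mpoly C[n]}),
  forall b, b i0 != 0 -> co b j * b i0 ^+ N = q.@[b].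
Hypothesis ptX : forall c, c j0 != 0 -> X (pt c).

Fact laurent_subst n' k' (i : 'I_n') (F : affine C n' -> affine C k') (q : {mpoly C[k']}) :
  (forall j, exists N (r : {mpoly C[n']}), forall b, b i != 0 -> F b j * b i ^+ N = r.@[b]) ->
  exists N (r : {mpoly C[n']}), forall b, b i != 0 -> q.@[F b] * b i ^+ N = r.@[b].
Proof.
move=> H; elim/mpoly_ring_ind: q => [c|j|p q [N [r Hr]] [M [s Hs]]|p q [N [r Hr]] [M [s Hs]]].
- by exists 0%N, c%:MP => b _; rewrite expr0 !mevalC mulr1.
- by have [N [r Hr]] := H j; exists N, r => b Hb; rewrite mevalXU Hr.
- exists (N + M)%N, (r * 'X_i ^+ M + s * 'X_i ^+ N) => b Hb.
  by rewrite !(mevalD, mevalM) !rmorphXn /= !mevalXU -Hr // -Hs // exprD; ring.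
- exists (N + M)%N, (r * s) => b Hb.
  by rewrite !mevalM -Hr // -Hs // exprD; ring.
Qed.

Lemma chart_fraction f : regular_on X f -> exists K (q : {mpoly C[k]}),
  forall c, c j0 != 0 -> f (pt c) * c j0 ^+ K = q.@[c].
Proof.
move=> reg; apply: (regular_principal_open (f := fun c => f (pt c))) => c Dc.
have [g [h [ha E]]] := regular_denominator reg (ptX Dc).
have [N [G HG]] := laurent_subst g pt_poly; have [M [H HH]] := laurent_subst h pt_poly.
exists (G * 'X_j0 ^+ M), (H * 'X_j0 ^+ N); split.
  by rewrite mevalM -HH // rmorphXn /= mevalXU !mulf_neq0 ?expf_neq0.
move=> b Db; rewrite !mevalM -HG // -HH // !rmorphXn /= mevalXU -E; last exact: ptX.
ring.
Qed.

Lemma chart_regular f K (q : {mpoly C[k]}) :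
  (forall b, X b -> b i0 != 0 -> f b * b i0 ^+ K = q.@[co b]) ->
  forall a, X a -> a i0 != 0 ->
    exists (V : set (affine C n)) (g h : {mpoly C[n]}),
      [/\ zariski_open_in X V, V a &
          forall b, V b -> h.@[b] != 0 /\ f b = g.@[b] / h.@[b]].
Proof.
move=> E a Xa a0; have [N [r Hr]] := laurent_subst q co_poly.
exists (X `&` [set b | b i0 != 0]), r, ('X_i0 ^+ (K + N)); split=> //.
- exists [set 'X_i0]; apply/seteqP; split=> b [Xb Hb]; split=> //.
    by move=> /(_ _ erefl); rewrite mevalXU => /eqP; rewrite (negPf Hb).
  by apply/negP => /eqP b0; apply: Hb => _ ->; rewrite mevalXU.
- move=> b [Xb /= b0]; rewrite rmorphXn /= mevalXU expf_neq0 //; split=> //.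
  by rewrite -Hr // -E // -[X in _ = X / _]mulrA -exprD mulfK // expf_neq0.
Qed.
End Chart.

(** * Functions on the charts and elements of K[T] *)

Section Agree.
Variables (C : numClosedFieldType) (K : diff_field C).
Local Notation emb := (df_emb K).
Local Notation cK := (fracC K).
Local Notation B := {poly K}.
Local Notation bX := (coordX K).
Local Notation bY := (coordY K).
Local Notation TP := {poly {poly {poly C}}}.

Definition vec3 (T : Type) (a b c : T) : 'I_3 -> T := tnth [tuple a; b; c].

Definition evB (w : 'I_3 -> B) (P : {mpoly C[3]}) : B := mmap (polyC \o cK) w P.

Lemma evB_C w c : evB w c%:MP = (cK c)%:P. Proof. exact: mmapC. Qed.
Lemma evB_X w i : evB w 'X_i = w i. Proof. by rewrite /evB mmapX mmap1U. Qed.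
Lemma evB_D w P Q : evB w (P + Q) = evB w P + evB w Q. Proof. exact: rmorphD. Qed.
Lemma evB_M w P Q : evB w (P * Q) = evB w P * evB w Q. Proof. exact: rmorphM. Qed.

Let tp (P : {mpoly C[3]}) : TP :=
  mmap (polyC \o (polyC \o polyC)) (vec3 'X%:P%:P 'X%:P 'X) P.

Lemma ord3P (Q : 'I_3 -> Prop) : Q 0 -> Q 1 -> Q (2 : 'I_3) -> forall i, Q i.
Proof.
move=> Q0 Q1 Q2 [[|[|[|i]]] Hi] //.
- by rewrite (_ : Ordinal Hi = 0) //; apply/val_inj.
- by rewrite (_ : Ordinal Hi = 1) //; apply/val_inj.
- by rewrite (_ : Ordinal Hi = 2) //; apply/val_inj.
Qed.

Lemma tp_horner P (c : affine C 3) :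
  (tp P).[(c 2)%:P%:P].[(c 1)%:P].[c 0] = P.@[c].
Proof.
elim/mpoly_ring_ind: P => [e|i|P Q EP EQ|P Q EP EQ].
- by rewrite /tp mmapC mevalC !hornerC.
- by rewrite /tp mmapX mmap1U mevalXU; elim/ord3P: i; rewrite /vec3 /= !(tnth_nth 0) /= !hornerE.
- by rewrite mevalD /tp rmorphD /= !hornerD EP EQ.
- by rewrite mevalM /tp rmorphM /= !hornerM EP EQ.
Qed.

Lemma tp_evB P : map_poly emb (tp P) = evB (vec3 bX bY 'X) P.
Proof.
elim/mpoly_ring_ind: P => [e|i|P Q EP EQ|P Q EP EQ].
- by rewrite /tp mmapC evB_C map_polyC.
- rewrite /tp mmapX mmap1U evB_X; elim/ord3P: i; rewrite /vec3 !(tnth_nth 0) /= ?map_polyC //.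
  exact: map_polyX.
- by rewrite evB_D -EP -EQ /tp !rmorphD.
- by rewrite evB_M -EP -EQ /tp !rmorphM.
Qed.

Lemma evB_eq0 P : evB (vec3 bX bY 'X) P = 0 -> forall c : affine C 3, P.@[c] = 0.
Proof.
rewrite -tp_evB => E c; rewrite -tp_horner (_ : tp P = 0) ?horner0 //.
apply/polyP => i; have := congr1 (fun R : B => R`_i) E; rewrite coef_map !coef0 => /eqP.
by rewrite emb_eq0 => /eqP.
Qed.

Lemma evB_vanish P :
  (forall c : affine C 3, c 0 != 0 -> c 1 != 0 -> P.@[c] = 0) ->
  evB (vec3 bX bY 'X) P = 0.
Proof.
move=> H; rewrite -tp_evB (_ : tp P = 0) ?rmorph0 //.
have char1 k : k.+1%:R != 0 :> {poly C} by rewrite -polyC_natr polyC_eq0 pnatr_eq0.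
have char2 k : k.+1%:R != 0 :> {poly {poly C}} by rewrite -polyC_natr polyC_eq0 char1.
apply: poly_eq0_nat => // k2; apply: poly_eq0_nat => // k1.
apply: poly_eq0_nat => [k|k0]; first by rewrite pnatr_eq0.
pose c := vec3 (k0.+1%:R : C) k1.+1%:R k2.+1%:R.
have := tp_horner P c; rewrite H; first last.
- by rewrite /c /vec3 (tnth_nth 0) pnatr_eq0.
- by rewrite /c /vec3 (tnth_nth 0) pnatr_eq0.
by rewrite /c /vec3 !(tnth_nth 0) /= -!polyC_natr.
Qed.
End Agree.

Section Reading.
Variables (C : numClosedFieldType) (K : diff_field C).
Local Notation emb := (df_emb K).
Local Notation cK := (fracC K).
Local Notation B := {poly K}.
Local Notation bX := (coordX K).
Local Notation bY := (coordY K).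
Local Notation ev0 := (evB (vec3 bX bY 'X)).
Local Notation overlap c := ((c 0 != 0) && (c 1 != 0)).
Implicit Types (F G : affine C 3 -> C) (w : B) (P : {mpoly C[3]}).

Lemma bX0 : bX != 0. Proof. by rewrite polyC_eq0 fracX_neq0. Qed.
Lemma bY0 : bY != 0. Proof. by rewrite polyC_eq0 fracY_neq0. Qed.

Lemma vec3_0 T (a b c : T) : vec3 a b c 0 = a. Proof. by rewrite /vec3 (tnth_nth a). Qed.
Lemma vec3_1 T (a b c : T) : vec3 a b c 1 = b. Proof. by rewrite /vec3 (tnth_nth a). Qed.
Lemma vec3_2 T (a b c : T) : vec3 a b c 2 = c. Proof. by rewrite /vec3 (tnth_nth a). Qed.
Definition vec3E := (vec3_0, vec3_1, vec3_2).
Lemma vec3_eta (c : affine C 3) : vec3 (c 0) (c 1) (c 2) = c.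
Proof. by apply/funext; elim/ord3P; rewrite !vec3E. Qed.

(** The Laurent polynomial w and the function F have the same values on the
    overlap of the charts, which has coordinates x, y, T. *)
Definition agree w F := exists N P, w * (bX * bY) ^+ N = ev0 P /\
  forall c, overlap c -> F c * (c 0 * c 1) ^+ N = P.@[c].

Lemma agree_ext w F G : agree w F -> (forall c, overlap c -> F c = G c) -> agree w G.
Proof. by move=> [N [P [E H]]] FG; exists N, P; split=> // c Hc; rewrite -FG ?H. Qed.

Lemma agree_poly P : agree (ev0 P) (fun c => P.@[c]).
Proof. by exists 0%N, P; split=> [|c _]; rewrite expr0 mulr1. Qed.

Lemma agree_C e : agree (cK e)%:P (fun=> e).
Proof. by have := agree_poly e%:MP; rewrite evB_C => /agree_ext; apply=> c _; rewrite mevalC. Qed.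

Lemma agree_X : agree bX (fun c => c 0).
Proof. by have := agree_poly 'X_0; rewrite evB_X vec3E => /agree_ext; apply=> c _; rewrite mevalXU. Qed.
Lemma agree_Y : agree bY (fun c => c 1).
Proof. by have := agree_poly 'X_1; rewrite evB_X vec3E => /agree_ext; apply=> c _; rewrite mevalXU. Qed.
Lemma agree_T : agree 'X (fun c => c 2).
Proof. by have := agree_poly 'X_2; rewrite evB_X vec3E => /agree_ext; apply=> c _; rewrite mevalXU. Qed.

Lemma agree_D v w F G : agree v F -> agree w G -> agree (v + w) (fun c => F c + G c).
Proof.
move=> [N [P [E H]]] [M [Q [E' H']]]; exists (N + M)%N.
exists (P * ('X_0 * 'X_1) ^+ M + Q * ('X_0 * 'X_1) ^+ N); split.
  rewrite evB_D !evB_M -E -E' /evB !rmorphXn !rmorphM /= -!/(evB _ _) !evB_X !vec3E exprD; ring.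
by move=> c Hc; rewrite mevalD !mevalM -H // -H' // !rmorphXn !rmorphM /= !mevalXU exprD; ring.
Qed.

Lemma agree_M v w F G : agree v F -> agree w G -> agree (v * w) (fun c => F c * G c).
Proof.
move=> [N [P [E H]]] [M [Q [E' H']]]; exists (N + M)%N, (P * Q); split.
  by rewrite evB_M -E -E' exprD; ring.
by move=> c Hc; rewrite mevalM -H // -H' // exprD; ring.
Qed.

Lemma agree_divX w F k : agree (w * bX ^+ k) (fun c => F c * c 0 ^+ k) -> agree w F.
Proof.
move=> [N [P [E H]]]; exists (N + k)%N, (P * 'X_1 ^+ k); split.
  rewrite evB_M -E /evB rmorphXn /= -/(evB _ _) evB_X vec3E exprD [(_ * _) ^+ k]exprMn; ring.
move=> c Hc; rewrite mevalM -H // rmorphXn /= mevalXU exprD [(_ * _) ^+ k]exprMn; ring.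
Qed.

Lemma agree_divY w F k : agree (w * bY ^+ k) (fun c => F c * c 1 ^+ k) -> agree w F.
Proof.
move=> [N [P [E H]]]; exists (N + k)%N, (P * 'X_0 ^+ k); split.
  rewrite evB_M -E /evB rmorphXn /= -/(evB _ _) evB_X vec3E exprD [(_ * _) ^+ k]exprMn; ring.
move=> c Hc; rewrite mevalM -H // rmorphXn /= mevalXU exprD [(_ * _) ^+ k]exprMn; ring.
Qed.

Lemma agree_evB (w : 'I_3 -> B) (H : affine C 3 -> affine C 3) P :
  (forall i, agree (w i) (fun c => H c i)) -> agree (evB w P) (fun c => P.@[H c]).
Proof.
move=> HF; elim/mpoly_ring_ind: P => [e|i|P Q IP IQ|P Q IP IQ].
- by rewrite evB_C; apply: agree_ext (agree_C e) _ => c _; rewrite mevalC.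
- by rewrite evB_X; apply: agree_ext (HF i) _ => c _; rewrite mevalXU.
- by rewrite evB_D; apply: agree_ext (agree_D IP IQ) _ => c _; rewrite mevalD.
- by rewrite evB_M; apply: agree_ext (agree_M IP IQ) _ => c _; rewrite mevalM.
Qed.

Lemma agree_fun w F G c : agree w F -> agree w G -> overlap c -> F c = G c.
Proof.
move=> [N [P [E H]]] [M [Q [E' H']]] Hc.
have : ev0 (P * ('X_0 * 'X_1) ^+ M + - (Q * ('X_0 * 'X_1) ^+ N)) = 0.
  by rewrite /evB rmorphB !rmorphM !rmorphXn !rmorphM /= -!/(evB _ _) !evB_X !vec3E -E -E'; ring.
move=> /evB_eq0 /(_ c); rewrite mevalD mevalN !mevalM -H // -H' // !rmorphXn !rmorphM /= !mevalXU.
move=> /eqP; rewrite subr_eq0 => /eqP EE; case/andP: Hc => c0 c1.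
apply: (@mulIf _ ((c 0 * c 1) ^+ N * (c 0 * c 1) ^+ M)).
  by rewrite mulf_neq0 // expf_neq0 // mulf_neq0.
by rewrite mulrA EE; ring.
Qed.

Lemma agree_inj v w F : agree v F -> agree w F -> v = w.
Proof.
move=> [N [P [E H]]] [M [Q [E' H']]].
have : ev0 (P * ('X_0 * 'X_1) ^+ M + - (Q * ('X_0 * 'X_1) ^+ N)) = 0.
  apply: evB_vanish => c c0 c1; have Hc : overlap c by rewrite c0.
  by rewrite mevalD mevalN !mevalM -H // -H' // !rmorphXn !rmorphM /= !mevalXU; ring.
rewrite /evB rmorphB !rmorphM !rmorphXn !rmorphM /= -!/(evB _ _) !evB_X !vec3E -E -E'.
move=> /eqP; rewrite subr_eq0 => /eqP EE.
apply: (@mulIf _ ((bX * bY) ^+ N * (bX * bY) ^+ M)).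
  by rewrite mulf_neq0 // expf_neq0 // mulf_neq0 ?bX0 ?bY0.
by rewrite mulrA EE; ring.
Qed.

(** The same on a whole chart, where the base coordinate a does not vanish and
    b may vanish. *)
Definition rep (a b w : B) F := exists k P, w * a ^+ k = evB (vec3 a b 'X) P /\
  forall c, c 0 != 0 -> F c * c 0 ^+ k = P.@[c].

Lemma rep_ext a b w F G : rep a b w F -> (forall c, c 0 != 0 -> F c = G c) -> rep a b w G.
Proof. by move=> [N [P [E H]]] FG; exists N, P; split=> // c Hc; rewrite -FG ?H. Qed.

Lemma rep_C a b e : rep a b (cK e)%:P (fun=> e).
Proof. by exists 0%N, e%:MP; rewrite evB_C expr0 mulr1; split=> // c _; rewrite mevalC mulr1. Qed.

Lemma rep_D a b v w F G : rep a b v F -> rep a b w G -> rep a b (v + w) (fun c => F c + G c).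
Proof.
move=> [N [P [E H]]] [M [Q [E' H']]]; exists (N + M)%N.
exists (P * 'X_0 ^+ M + Q * 'X_0 ^+ N); split.
  rewrite evB_D !evB_M -E -E' /evB !rmorphXn /= -!/(evB _ _) !evB_X !vec3E exprD; ring.
by move=> c Hc; rewrite mevalD !mevalM -H // -H' // !rmorphXn /= !mevalXU exprD; ring.
Qed.

Lemma rep_M a b v w F G : rep a b v F -> rep a b w G -> rep a b (v * w) (fun c => F c * G c).
Proof.
move=> [N [P [E H]]] [M [Q [E' H']]]; exists (N + M)%N, (P * Q); split.
  by rewrite evB_M -E -E' exprD; ring.
by move=> c Hc; rewrite mevalM -H // -H' // exprD; ring.
Qed.

Lemma evB_swap P : exists P', (forall a b : B, evB (vec3 a b 'X) P' = evB (vec3 b a 'X) P) /\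
  forall c, P'.@[c] = P.@[vec3 (c 1) (c 0) (c 2)].
Proof.
elim/mpoly_ring_ind: P => [e|i|P Q [P' [EP HP]] [Q' [EQ HQ]]|P Q [P' [EP HP]] [Q' [EQ HQ]]].
- by exists e%:MP; split=> *; rewrite ?evB_C ?mevalC.
- elim/ord3P: i; [exists 'X_1|exists 'X_0|exists 'X_2];
    by split=> *; rewrite ?evB_X ?mevalXU !vec3E.
- by exists (P' + Q'); split=> *; rewrite ?evB_D ?mevalD ?EP ?EQ ?HP ?HQ.
- by exists (P' * Q'); split=> *; rewrite ?evB_M ?mevalM ?EP ?EQ ?HP ?HQ.
Qed.

Lemma rep_fun (a b w : B) F G c : (a, b) = (bX, bY) \/ (a, b) = (bY, bX) ->
  rep a b w F -> rep a b w G -> c 0 != 0 -> F c = G c.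
Proof.
move=> ab [N [P [E H]]] [M [Q [E' H']]] c0.
pose R := P * 'X_0 ^+ M + - (Q * 'X_0 ^+ N).
have R0 : evB (vec3 a b 'X) R = 0.
  by rewrite /evB rmorphB !rmorphM !rmorphXn /= -!/(evB _ _) !evB_X !vec3E -E -E'; ring.
have : R.@[c] = 0.
  case: ab => -[Ea Eb]; subst a b; first exact: evB_eq0 R0 c.
  have [R' [ER HR]] := evB_swap R; have := @evB_eq0 _ K R'.
  rewrite ER R0 => /(_ erefl (vec3 (c 1) (c 0) (c 2))).
  by rewrite HR !vec3E vec3_eta.
rewrite mevalD mevalN !mevalM -H // -H' // !rmorphXn /= !mevalXU.
move=> /eqP; rewrite subr_eq0 => /eqP EE.
apply: (@mulIf _ (c 0 ^+ N * c 0 ^+ M)); first by rewrite mulf_neq0 // expf_neq0.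
by rewrite mulrA EE; ring.
Qed.

Lemma evB_polyOver s (w : 'I_3 -> B) P : (forall i, w i \is a polyOver (@loc _ K s)) ->
  evB w P \is a polyOver (@loc _ K s).
Proof.
move=> H; elim/mpoly_ring_ind: P => [e|i|P Q IP IQ|P Q IP IQ].
- by rewrite evB_C polyOver_embC.
- by rewrite evB_X.
- by rewrite evB_D; exact: (rpredD IP IQ).
- by rewrite evB_M; exact: (rpredM IP IQ).
Qed.

Lemma rep_polyOver s b w F : s != 0 -> b \is a polyOver (@loc _ K s) ->
  rep (emb s)%:P b w F -> w \is a polyOver (@loc _ K s).
Proof.
move=> s0 Hb [k [P [E _]]].
have es0 : emb s != 0 by rewrite emb_eq0.
have -> : w = evB (vec3 (emb s)%:P b 'X) P * ((emb s ^+ k)^-1)%:P.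
  by rewrite -E -mulrA -polyC_exp -polyCM divff ?mulr1 // expf_neq0.
rewrite rpredM //; last by rewrite polyOverC loc_inv.
apply: evB_polyOver; elim/ord3P; rewrite !vec3E ?polyOverX ?polyOver_embC //.
Qed.

Lemma emb_evB (Q : {poly {poly C}}) : exists P, ev0 P = (emb Q)%:P.
Proof.
elim/poly_ind: Q => [|Q q [P EP]].
  by exists 0; rewrite /evB !rmorph0.
have [R ER] : exists P, ev0 P = (emb q%:P)%:P.
  elim/poly_ind: q => [|q e [R ER]]; first by exists 0; rewrite /evB !rmorph0.
  exists (R * 'X_0 + e%:MP); rewrite evB_D evB_M evB_X evB_C ER vec3E.
  by rewrite polyCD polyCM (rmorphD emb) (rmorphM emb) polyCD polyCM.
exists (P * 'X_1 + R); rewrite evB_D evB_M evB_X vec3E EP ER.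
by rewrite (rmorphD emb) (rmorphM emb) polyCD polyCM.
Qed.

Lemma polyOver_evB s w : w \is a polyOver (@loc _ K s) ->
  exists k P, w * (emb s)%:P ^+ k = ev0 P.
Proof.
elim/poly_ind: w => [|w c IH].
  by exists 0%N, 0; rewrite mul0r /evB rmorph0.
move=> /polyOverP H.
have /IH [k [P HP]] : w \is a polyOver (@loc _ K s).
  by apply/polyOverP => i; have := H i.+1; rewrite coefD coefMX coefC addr0.
have /locP[l [Q HQ]] : c \in @loc _ K s by have := H 0%N; rewrite coefD coefMX coefC add0r.
have [S ES] := emb_evB s; have [R ER] := emb_evB Q.
exists (k + l)%N, (P * S ^+ l * 'X_2 + R * S ^+ k).
rewrite evB_D !evB_M evB_X vec3E -HP ER -HQ polyCM polyC_exp.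
by rewrite /evB !rmorphXn /= -!/(evB _ _) ES exprD; ring.
Qed.
End Reading.

(** * The two charts of the variety *)

Section Variety.
Variables (C : numClosedFieldType) (K : diff_field C).
Local Notation emb := (df_emb K).
Local Notation cK := (fracC K).
Local Notation B := {poly K}.
Local Notation bX := (coordX K).
Local Notation bY := (coordY K).
Local Notation ev0 := (evB (vec3 bX bY 'X)).
Local Notation overlap c := ((c 0 != 0) && (c 1 != 0)).

Definition vec4 (T : Type) (a b c d : T) : 'I_4 -> T := tnth [tuple a; b; c; d].
Lemma vec4_0 T (a b c d : T) : vec4 a b c d 0 = a. Proof. by rewrite /vec4 (tnth_nth a). Qed.
Lemma vec4_1 T (a b c d : T) : vec4 a b c d 1 = b. Proof. by rewrite /vec4 (tnth_nth a). Qed.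
Lemma vec4_2 T (a b c d : T) : vec4 a b c d 2 = c. Proof. by rewrite /vec4 (tnth_nth a). Qed.
Lemma vec4_3 T (a b c d : T) : vec4 a b c d 3 = d. Proof. by rewrite /vec4 (tnth_nth a). Qed.
Definition vec4E := (vec4_0, vec4_1, vec4_2, vec4_3).
Lemma ord4P (Q : 'I_4 -> Prop) : Q 0 -> Q 1 -> Q (2 : 'I_4) -> Q (3 : 'I_4) -> forall i, Q i.
Proof.
move=> Q0 Q1 Q2 Q3 [[|[|[|[|i]]]] Hi] //.
- by rewrite (_ : Ordinal Hi = 0) //; apply/val_inj.
- by rewrite (_ : Ordinal Hi = 1) //; apply/val_inj.
- by rewrite (_ : Ordinal Hi = 2) //; apply/val_inj.
- by rewrite (_ : Ordinal Hi = 3) //; apply/val_inj.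
Qed.

Variables (m n : nat) (p : {mpoly C[2]}).
Local Notation pe x y := (p.@[tnth [tuple x; y]]).

Definition bipoly : {poly {poly C}} :=
  mmap (polyC \o polyC) (tnth [tuple xP C; yP C]) p.

Lemma meval_bipoly : exists P : {mpoly C[3]},
  ev0 P = (emb bipoly)%:P /\ forall c : affine C 3, P.@[c] = pe (c 0) (c 1).
Proof.
rewrite /bipoly; elim/mpoly_ring_ind: p => [e|i|P Q [P' [EP HP]] [Q' [EQ HQ]]|P Q [P' [EP HP]] [Q' [EQ HQ]]].
- by exists e%:MP; rewrite evB_C mmapC; split=> // c; rewrite !mevalC.
- rewrite mmapX mmap1U; case: i => -[|[|//]] Hi; [exists 'X_0|exists 'X_1];
    by rewrite evB_X vec3E; split=> [|c]; rewrite ?mevalXU !(tnth_nth 0).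
- exists (P' + Q'); split=> [|c]; last by rewrite !mevalD HP HQ.
  by rewrite evB_D EP EQ (rmorphD (mmap _ _)) (rmorphD emb) polyCD.
- exists (P' * Q'); split=> [|c]; last by rewrite !mevalM HP HQ.
  by rewrite evB_M EP EQ (rmorphM (mmap _ _)) (rmorphM emb) polyCM.
Qed.

Local Notation g := (transition K m n bipoly).
Definition gfun (c : affine C 3) : C := pe (c 0) (c 1) / (c 0 ^+ m * c 1 ^+ n).

Lemma agree_transition : agree g%:P gfun.
Proof.
apply: (@agree_divX _ _ _ _ m); apply: (@agree_divY _ _ _ _ n).
have [P [EP HP]] := meval_bipoly.
have -> : g%:P * bX ^+ m * bY ^+ n = ev0 P.
  rewrite EP /coordX /coordY -!polyC_exp -!polyCM -mulrA divfK //.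
  by rewrite mulf_neq0 ?expf_neq0 ?fracX_neq0 ?fracY_neq0.
apply: agree_ext (agree_poly K P) _ => c /andP[c0 c1].
by rewrite HP /gfun -mulrA divfK // mulf_neq0 ?expf_neq0.
Qed.

Definition ptx (c : affine C 3) : affine C 4 :=
  vec4 (c 0) (c 1) (c 0 ^+ m * c 2) ((pe (c 0) (c 1) + c 1 ^+ n * (c 0 ^+ m * c 2)) / c 0 ^+ m).
Definition pty (c : affine C 3) : affine C 4 :=
  vec4 (c 1) (c 0) ((c 1 ^+ m * (c 0 ^+ n * c 2) - pe (c 1) (c 0)) / c 0 ^+ n) (c 0 ^+ n * c 2).
Definition cox (b : affine C 4) : affine C 3 := vec3 (b 0) (b 1) (b 2 / b 0 ^+ m).
Definition coy (b : affine C 4) : affine C 3 := vec3 (b 1) (b 0) (b 3 / b 1 ^+ n).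

Local Notation X := (X_variety m n p).

Lemma ptxX c : c 0 != 0 -> X (ptx c).
Proof.
move=> c0; rewrite /X_variety /= /ptx !vec4E; split; last by case=> /eqP; rewrite (negPf c0).
by rewrite mulrC divfK ?expf_neq0 // addrK.
Qed.

Lemma ptyX c : c 0 != 0 -> X (pty c).
Proof.
move=> c0; rewrite /X_variety /= /pty !vec4E; split; last by case=> _ /eqP; rewrite (negPf c0).
by rewrite [c 0 ^+ n * (_ / _)]mulrC divfK ?expf_neq0 // opprB addrC subrK.
Qed.

Lemma ptxK b : X b -> b 0 != 0 -> ptx (cox b) = b.
Proof.
rewrite /X_variety /= => -[E _] b0; have bm0 : b 0 ^+ m != 0 by rewrite expf_neq0.
have E2 : b 0 ^+ m * (b 2 / b 0 ^+ m) = b 2 by rewrite mulrC divfK.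
apply/funext; elim/ord4P; rewrite /ptx /cox !vec3E !vec4E ?E2 //.
by rewrite -E subrK mulrC mulKf.
Qed.

Lemma ptyK b : X b -> b 1 != 0 -> pty (coy b) = b.
Proof.
rewrite /X_variety /= => -[E _] b0; have bm0 : b 1 ^+ n != 0 by rewrite expf_neq0.
have E2 : b 1 ^+ n * (b 3 / b 1 ^+ n) = b 3 by rewrite mulrC divfK.
apply/funext; elim/ord4P; rewrite /pty /coy !vec3E !vec4E ?E2 //.
by rewrite -E opprB addrC subrK mulrC mulKf.
Qed.

Lemma ptx_poly i : exists N (q : {mpoly C[3]}),
  forall c, c 0 != 0 -> ptx c i * c 0 ^+ N = q.@[c].
Proof.
have [P [_ HP]] := meval_bipoly.
elim/ord4P: i.
- by exists 0%N, 'X_0 => c _; rewrite /ptx vec4E mulr1 mevalXU.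
- by exists 0%N, 'X_1 => c _; rewrite /ptx vec4E mulr1 mevalXU.
- exists 0%N, ('X_0 ^+ m * 'X_2) => c _.
  by rewrite /ptx vec4E mulr1 rmorphM rmorphXn /= !mevalXU.
- exists m, (P + 'X_1 ^+ n * ('X_0 ^+ m * 'X_2)) => c c0.
  rewrite /ptx vec4E divfK ?expf_neq0 // rmorphD !rmorphM !rmorphXn /= !mevalXU.
  by rewrite HP.
Qed.

Lemma pty_poly i : exists N (q : {mpoly C[3]}),
  forall c, c 0 != 0 -> pty c i * c 0 ^+ N = q.@[c].
Proof.
have [P [_ HP]] := meval_bipoly; have [P' [_ HP']] := @evB_swap _ K P.
elim/ord4P: i.
- by exists 0%N, 'X_1 => c _; rewrite /pty vec4E mulr1 mevalXU.
- by exists 0%N, 'X_0 => c _; rewrite /pty vec4E mulr1 mevalXU.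
- exists n, ('X_1 ^+ m * ('X_0 ^+ n * 'X_2) - P') => c c0.
  rewrite /pty vec4E divfK ?expf_neq0 // rmorphB !rmorphM !rmorphXn /= !mevalXU.
  by rewrite HP' HP !vec3E.
- exists 0%N, ('X_0 ^+ n * 'X_2) => c _.
  by rewrite /pty vec4E mulr1 rmorphM rmorphXn /= !mevalXU.
Qed.

Lemma cox_poly j : exists N (q : {mpoly C[4]}),
  forall b, b 0 != 0 -> cox b j * b 0 ^+ N = q.@[b].
Proof.
elim/ord3P: j; [exists 0%N, 'X_0|exists 0%N, 'X_1|exists m, 'X_2] => b b0;
  by rewrite /cox vec3E mevalXU ?mulr1 // divfK // expf_neq0.
Qed.

Lemma coy_poly j : exists N (q : {mpoly C[4]}),
  forall b, b 1 != 0 -> coy b j * b 1 ^+ N = q.@[b].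
Proof.
elim/ord3P: j; [exists 0%N, 'X_1|exists 0%N, 'X_0|exists n, 'X_3] => b b0;
  by rewrite /coy vec3E mevalXU ?mulr1 // divfK // expf_neq0.
Qed.

(** f is the regular function on the variety given by w on the two charts. *)
Definition reads (w : B) (f : affine C 4 -> C) : Prop :=
  rep bX bY w (f \o ptx) /\ rep bY bX (shear g w) (f \o pty).

Lemma reads_reg w f : reads w f -> w \in reg g.
Proof.
move=> [Hx Hy]; apply/regP; split.
  by apply: rep_polyOver Hx; rewrite ?xP_neq0 // polyOver_embC.
by apply: rep_polyOver Hy; rewrite ?yP_neq0 // polyOver_embC.
Qed.

Lemma reads_ext w f f' : reads w f -> (forall a, X a -> f a = f' a) -> reads w f'.
Proof.
move=> [Hx Hy] E; split; [apply: rep_ext Hx _|apply: rep_ext Hy _] => c c0 /=.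
  by rewrite E //; exact: ptxX.
by rewrite E //; exact: ptyX.
Qed.

Lemma reads_C e : reads (cK e)%:P (fun=> e).
Proof. by split; rewrite ?shearC; exact: rep_C. Qed.

Lemma reads_D v w f f' : reads v f -> reads w f' -> reads (v + w) (fun a => f a + f' a).
Proof. by move=> [? ?] [? ?]; split; rewrite ?rmorphD; exact: rep_D. Qed.

Lemma reads_M v w f f' : reads v f -> reads w f' -> reads (v * w) (fun a => f a * f' a).
Proof. by move=> [? ?] [? ?]; split; rewrite ?rmorphM; exact: rep_M. Qed.

Lemma reads_fun w f f' a : reads w f -> reads w f' -> X a -> f a = f' a.
Proof.
move=> [Hx Hy] [Hx' Hy'] Xa; have [b0|b0] := eqVneq (a 0) 0.
  have b1 : a 1 != 0 by apply/eqP => b1; case: Xa => _; apply.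
  rewrite -(ptyK Xa b1).
  by apply: (rep_fun (or_intror erefl) Hy Hy'); rewrite /coy vec3E.
rewrite -(ptxK Xa b0).
by apply: (rep_fun (or_introl erefl) Hx Hx'); rewrite /cox vec3E.
Qed.

Lemma rep_agree w F : rep bX bY w F -> agree w F.
Proof.
move=> [k [P [E H]]]; apply: (@agree_divX _ _ _ _ k); rewrite E.
by apply: agree_ext (agree_poly K P) _ => c /andP[c0 _]; rewrite H.
Qed.

Lemma reads_inj v w f : reads v f -> reads w f -> v = w.
Proof. by move=> [/rep_agree H _] [/rep_agree H' _]; exact: agree_inj H H'. Qed.

(** The coordinates y, x, T + g of the point with coordinates x, y, T. *)
Let tau (c : affine C 3) : affine C 3 := vec3 (c 1) (c 0) (c 2 + gfun c).

Lemma rep_agree_y w F : rep bY bX (shear g w) F -> agree w (F \o tau).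
Proof.
move=> [k [P [E H]]]; apply: (@agree_divY _ _ _ _ k).
have -> : w * bY ^+ k = evB (vec3 bY bX ('X + g%:P)) P.
  apply: (@shear_inj _ g); rewrite rmorphM rmorphXn /= shearC E.
  elim/mpoly_ring_ind: (P) => [e|i|Q R IQ IR|Q R IQ IR].
  - by rewrite !evB_C shearC.
  - by rewrite !evB_X; elim/ord3P: i; rewrite !vec3E ?shearC // rmorphD /= shearX shearC subrK.
  - by rewrite !evB_D rmorphD IQ IR.
  - by rewrite !evB_M rmorphM IQ IR.
have H' : agree (evB (vec3 bY bX ('X + g%:P)) P) (fun c => P.@[tau c]).
  apply: agree_evB; elim/ord3P; rewrite vec3E.
  - by apply: agree_ext (agree_Y K) _ => c _; rewrite /tau vec3E.
  - by apply: agree_ext (agree_X K) _ => c _; rewrite /tau vec3E.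
  - by apply: agree_ext (agree_D (agree_T K) agree_transition) _ => c _; rewrite /tau vec3E.
apply: agree_ext H' _ => c /andP[c0 c1]; rewrite -H /tau /= ?vec3E //.
Qed.

Lemma pt_tau c : overlap c -> pty (tau c) = ptx c.
Proof.
move=> /andP[c0 c1]; have m0 : c 0 ^+ m != 0 by rewrite expf_neq0.
have n0 : c 1 ^+ n != 0 by rewrite expf_neq0.
apply/funext; rewrite /pty /ptx /tau /gfun.
elim/ord4P; rewrite !vec3E !vec4E //; move: m0 n0;
  move: (c 0 ^+ m) (c 1 ^+ n) (pe (c 0) (c 1)) => a b e a0 b0; field; rewrite ?a0 ?b0 //.
Qed.

Fact rep_of_polynomial s b F k P : s != 0 -> (forall c, c 0 != 0 -> F c * c 0 ^+ k = P.@[c]) ->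
  rep (emb s)%:P b (evB (vec3 (emb s)%:P b 'X) P * ((emb s ^+ k)^-1)%:P) F.
Proof.
move=> s0 H; exists k, P; split=> //.
by rewrite -mulrA -polyC_exp -polyCM mulVf ?mulr1 // expf_neq0 // emb_eq0.
Qed.

(** Regular functions are Laurent polynomials on each chart, and these agree on
    the overlap. *)
Lemma regular_reads f : regular_on X f -> exists w, reads w f.
Proof.
move=> reg.
have [k [P HP]] := chart_fraction ptx_poly ptxX reg.
have [l [Q HQ]] := chart_fraction pty_poly ptyX reg.
have Hx := rep_of_polynomial bY (xP_neq0 C) HP; have Hy := rep_of_polynomial bX (yP_neq0 C) HQ.
set w := _ * _ in Hx; set w' := _ * _ in Hy.
exists w; split=> //; suff -> : shear g w = w' by [].
rewrite -(shearNK g w'); congr (shear g _).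
apply: agree_inj (rep_agree Hx) _; rewrite -(shearNK g w') in Hy.
by apply: agree_ext (rep_agree_y Hy) _ => c Hc /=; rewrite pt_tau.
Qed.

Lemma reads_regular w f : reads w f -> regular_on X f.
Proof.
move=> [[k [P [_ HP]]] [l [Q [_ HQ]]]] a Xa; have [b0|b0] := eqVneq (a 0) 0.
  have b1 : a 1 != 0 by apply/eqP => b1; case: Xa => _; apply.
  apply: (chart_regular coy_poly (q := Q) (K := l)) => // b Xb b1'.
  by rewrite -HQ /= ?(ptyK Xb) // /coy vec3E.
apply: (chart_regular cox_poly (q := P) (K := k)) => // b Xb b1'.
by rewrite -HP /= ?(ptxK Xb) // /cox vec3E.
Qed.

Lemma reg_reads w : w \in reg g -> exists f, reads w f.
Proof.
move=> /regP[Hx Hy]; have [k [P EP]] := polyOver_evB Hx.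
have [l [Q' EQ']] := polyOver_evB Hy.
have [Q [EQ _]] := @evB_swap _ K Q'; have {EQ} EQ := EQ bY bX; rewrite -EQ' in EQ.
pose f a := if a 0 != 0 then P.@[cox a] / a 0 ^+ k else Q.@[coy a] / a 1 ^+ l.
have Rx : rep bX bY w (f \o ptx).
  exists k, P; split; first exact: EP.
  move=> c c0; rewrite /= /f /ptx vec4E c0 /cox !vec4E.
  by rewrite divfK ?expf_neq0 // [c 0 ^+ m * _]mulrC mulfK ?expf_neq0 // vec3_eta.
exists f; split; first exact: Rx.
exists l, Q; split; first exact: esym EQ.
move=> c c0.
rewrite /= /f [pty c 0]/pty vec4E; have [c1|c1] /= := eqVneq (c 1) 0.
  rewrite /coy /pty !vec4E [c 0 ^+ n * _]mulrC mulfK ?expf_neq0 //.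
  by rewrite ?divfK ?expf_neq0 // vec3_eta.
have Ry : rep bY bX (shear g w) (fun c => Q.@[c] / c 0 ^+ l).
  by exists l, Q; split; [exact: esym EQ|move=> d d0; rewrite divfK // expf_neq0].
pose d := vec3 (c 1) (c 0) (c 2 - gfun (vec3 (c 1) (c 0) 0)).
have Hd : overlap d by rewrite /d !vec3E c1 c0.
have taud : tau d = c.
  apply/funext; rewrite /tau /d; elim/ord3P; rewrite !vec3E // /gfun !vec3E.
  by rewrite subrK.
have := agree_fun (rep_agree Rx) (rep_agree_y Ry) Hd.
rewrite /= -(pt_tau Hd) taud /f [pty c 0]/pty vec4E c1 => ->.
by rewrite divfK // expf_neq0.
Qed.
End Variety.

(** * Pullback of regular functions *)

Section Pullback.
Variables (C : numClosedFieldType) (K : diff_field C).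
Local Notation B := {poly K}.
Variables (m1 n1 m2 n2 : nat) (p1 p2 : {mpoly C[2]}).
Local Notation X1 := (X_variety m1 n1 p1).
Local Notation X2 := (X_variety m2 n2 p2).
Local Notation g1 := (transition K m1 n1 (bipoly p1)).
Local Notation g2 := (transition K m2 n2 (bipoly p2)).
Local Notation reads1 := (@reads C K m1 n1 p1).
Local Notation reads2 := (@reads C K m2 n2 p2).

(** The element of K[T] that gives f \o phi, where f is the regular function
    given by w. *)
Definition pullback (phi : affine C 4 -> affine C 4) (w : B) : B :=
  xget 0 [set v | exists f, reads2 w f /\ reads1 v (f \o phi)].

Variable phi : affine C 4 -> affine C 4.
Hypothesis Hphi : morphism X1 X2 phi.

Lemma pullbackE w v f : reads2 w f -> reads1 v (f \o phi) -> pullback phi w = v.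
Proof.
move=> Hw Hv; rewrite /pullback; case: xgetP => [v' -> [f' [Hw' Hv']]|/(_ v)]; last first.
  by case; exists f.
apply: (reads_inj Hv'); apply: reads_ext Hv _ => a Xa /=.
apply: (reads_fun Hw Hw'); by case: Hphi => H _ _; exact: H.
Qed.

Lemma pullback_ex w : w \in reg g2 -> exists v f, reads2 w f /\ reads1 v (f \o phi).
Proof.
move=> /reg_reads[f Hf]; case: Hphi => HX _ /(_ X2 f) H.
have XX : zariski_open_in X2 X2.
  exists [set 1]; apply/seteqP; split=> [b Xb|b []//]; split=> // /(_ 1 erefl).
  by rewrite meval1 => /eqP; rewrite oner_eq0.
have := H XX (reads_regular Hf).
have -> : X1 `&` phi @^-1` X2 = X1.
  by apply/seteqP; split=> [b []//|b Xb]; split=> //; exact: HX.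
by move=> /(regular_reads K)[v Hv]; exists v, f.
Qed.

Lemma pullback_hom : alg_hom g2 g1 (pullback phi).
Proof.
split=> [w|v w|v w|c].
- by move=> /pullback_ex[v [f [Hw Hv]]]; rewrite (pullbackE Hw Hv); exact: reads_reg Hv.
- move=> /pullback_ex[v' [f [Hv Hv']]] /pullback_ex[w' [f' [Hw Hw']]].
  rewrite (pullbackE Hv Hv') (pullbackE Hw Hw').
  exact: (pullbackE (reads_D Hv Hw) (reads_D Hv' Hw')).
- move=> /pullback_ex[v' [f [Hv Hv']]] /pullback_ex[w' [f' [Hw Hw']]].
  rewrite (pullbackE Hv Hv') (pullbackE Hw Hw').
  exact: (pullbackE (reads_M Hv Hw) (reads_M Hv' Hw')).
- exact: (pullbackE (f := fun=> c) (reads_C _ _ _ _ _) (reads_C _ _ _ _ _)).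
Qed.
End Pullback.

Lemma pullbackK (C : numClosedFieldType) (K : diff_field C) m1 n1 m2 n2
    (p1 p2 : {mpoly C[2]}) phi psi :
  morphism (X_variety m1 n1 p1) (X_variety m2 n2 p2) phi ->
  morphism (X_variety m2 n2 p2) (X_variety m1 n1 p1) psi ->
  (forall b, X_variety m2 n2 p2 b -> phi (psi b) = b) ->
  forall w, w \in reg (transition K m2 n2 (bipoly p2)) ->
    pullback m2 n2 m1 n1 p2 p1 psi (pullback m1 n1 m2 n2 p1 p2 phi w) = w.
Proof.
move=> Hphi Hpsi K2 w /(pullback_ex Hphi)[v [f [Hw Hv]]].
rewrite (pullbackE Hphi Hw Hv); apply: (pullbackE Hpsi Hv).
by apply: reads_ext Hw _ => b Xb /=; rewrite K2.
Qed.

(** * Degrees and the coefficient of x^(m-1) y^(n-1) *)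

Section Coefficients.
Variables (C : numClosedFieldType).
Implicit Type p : {mpoly C[2]}.

Definition mon (i j : nat) : 'X_{1..2} := [multinom nth 0%N [:: i; j] k | k < 2].

Lemma mon_eq (mm : 'X_{1..2}) i j : (mm ord0 == i) && (mm ord_max == j) = (mm == mon i j).
Proof.
apply/andP/eqP => [[/eqP E0 /eqP E1]|->]; last by rewrite !mnmE.
by apply/mnmP => -[[|[|//]] Hk]; rewrite mnmE /= -?E0 -?E1; congr (mm _); apply/val_inj.
Qed.

Fact coef_monomial (c : C) a b i j :
  (c%:P%:P * (xP C ^+ a * yP C ^+ b))`_j`_i = c * ((a == i) && (b == j))%:R.
Proof.
rewrite /xP /yP -polyC_exp mulrA -polyCM coefCM coefXn mulr_natr coefMn coefCM coefXn.
rewrite [j == b]eq_sym [i == a]eq_sym.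
by case: eqP; case: eqP; rewrite ?mulr1n ?mulr0n ?mulr0 ?mulr1.
Qed.

Lemma coef_bipoly p i j : (bipoly p)`_j`_i = p@_(mon i j).
Proof.
rewrite /bipoly /mmap !coef_sum.
transitivity (\sum_(mm <- msupp p) p@_mm * (mm == mon i j)%:R).
  apply: eq_bigr => mm _; rewrite /mmap1 !big_ord_recl big_ord0 mulr1 /=.
  rewrite !(tnth_nth 0) /= coef_monomial -mon_eq.
  by congr (_ * ((_ && (mm _ == _))%:R)); apply/val_inj.
have [H|H] := boolP (mon i j \in msupp p).
  rewrite (bigD1_seq _ H) //= eqxx mulr1 big1 ?addr0 // => mm /negPf ->.
  by rewrite mulr0.
rewrite (memN_msupp_eq0 H) big_seq big1 // => mm Hm.
by case: eqP => [E|_]; rewrite ?mulr0 // E (negPf H) in Hm *.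
Qed.

Lemma msupp_deg_var p mm k : mm \in msupp p -> (mm k <= deg_var k p)%N.
Proof. by move=> H; exact: (@leq_bigmax_seq _ _ xpredT (fun mm : 'X_{1..2} => mm k) _ H isT). Qed.

Lemma size_bipoly p n : (deg_var ord_max p < n)%N -> (size (bipoly p) <= n)%N.
Proof.
move=> H; apply/leq_sizeP => j nj; apply/polyP => i; rewrite coef_bipoly coef0.
apply: memN_msupp_eq0; apply/negP => /(msupp_deg_var ord_max).
by rewrite mnmE /= leqNgt (leq_trans H).
Qed.

Lemma size_coef_bipoly p m j : (deg_var ord0 p < m)%N -> (size ((bipoly p)`_j)%R <= m)%N.
Proof.
move=> H; apply/leq_sizeP => i ni; rewrite coef_bipoly.
apply: memN_msupp_eq0; apply/negP => /(msupp_deg_var ord0).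
by rewrite mnmE /= leqNgt (leq_trans H).
Qed.

Lemma mdeg_mon i j : mdeg (mon i j) = (i + j)%N.
Proof. by rewrite mdegE !big_ord_recl big_ord0 !mnmE addn0. Qed.

Lemma mon_eta (mm : 'X_{1..2}) : mm = mon (mm ord0) (mm ord_max).
Proof. by apply/eqP; rewrite -mon_eq !eqxx. Qed.

Lemma bipoly_neq0 p : p != 0 -> bipoly p != 0.
Proof.
move=> p0; have := mleadc_eq0 p; rewrite (negPf p0) (mon_eta (mlead p)) -coef_bipoly.
by move=> /negbT; apply: contraNneq => ->; rewrite !coef0.
Qed.

(** The degree bounds in x and y leave x^(m-1) y^(n-1) as the only monomial of
    total degree m + n - 2. *)
Lemma top_coef_neq0 p m n : p != 0 -> (deg_var ord0 p < m)%N -> (deg_var ord_max p < n)%N ->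
  deg p = (m + n - 2)%N -> (bipoly p)`_n.-1`_m.-1 != 0.
Proof.
move=> p0 Hx Hy Hd; rewrite coef_bipoly -mcoeff_msupp.
have lp := mlead_supp p0; have E := mlead_deg p0.
have x := msupp_deg_var ord0 lp; have y := msupp_deg_var ord_max lp.
suff <- : mlead p = mon m.-1 n.-1 by [].
move: Hd; rewrite /deg -E /= [X in mdeg X]mon_eta mdeg_mon => Hd.
apply/eqP; rewrite -mon_eq; apply/andP; split; apply/eqP; lia.
Qed.

Lemma top_coef_eq0 p m n : (0 < m)%N -> (0 < n)%N ->
  (deg p < m + n - 2)%N -> (bipoly p)`_n.-1`_m.-1 = 0.
Proof.
move=> m0 n0; rewrite coef_bipoly /deg => Hd; apply: memN_msupp_eq0; apply/negP.
move=> /msize_mdeg_lt; rewrite mdeg_mon; move: Hd; move: (msize p) => s; lia.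
Qed.
End Coefficients.

Theorem theorem2p5 (R : realType) (m1 n1 m2 n2 : nat)
    (p1 p2 : {mpoly R[i][2]})
    (hm1 : (1 <= m1)%N) (hn1 : (1 <= n1)%N)
    (hm2 : (1 <= m2)%N) (hn2 : (1 <= n2)%N)
    (hx1 : ~ divisible_by_var ord0 p1)
    (hy1 : ~ divisible_by_var ord_max p1)
    (hx2 : ~ divisible_by_var ord0 p2)
    (hy2 : ~ divisible_by_var ord_max p2)
    (hdx1 : (deg_var ord0 p1 < m1)%N)
    (hdy1 : (deg_var ord_max p1 < n1)%N)
    (hdx2 : (deg_var ord0 p2 < m2)%N)
    (hdy2 : (deg_var ord_max p2 < n2)%N)
    (hdeg1 : deg p1 = (m1 + n1 - 2)%N)
    (hdeg2 : (deg p2 < m2 + n2 - 2)%N) :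
  ~ isomorphic (X_variety m1 n1 p1) (X_variety m2 n2 p2).
Proof.
move=> [phi [psi [Hphi Hpsi K1 K2]]].
have [K _] := diff_field_exists (R[i] : numClosedFieldType).
have neq0 (q : {mpoly R[i][2]}) : ~ divisible_by_var ord0 q -> q != 0.
  by move=> H; apply/eqP => q0; apply: H; exists 0; rewrite q0 mulr0.
have p10 := neq0 _ hx1; have p20 := neq0 _ hx2.
have := top_coef_neq0 p10 hdx1 hdy1 hdeg1; apply/negP; rewrite negbK; apply/eqP.
apply: (residue_invariant hm1 hn1 hm2 hn2 _ _ _ _ _ _
  (pullback_hom K Hphi) (pullback_hom K Hpsi)).
- by move=> j; exact: size_coef_bipoly.
- exact: size_bipoly.
- by move=> j; exact: size_coef_bipoly.
- exact: size_bipoly.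
- exact: bipoly_neq0.
- exact: bipoly_neq0.
- exact: (pullbackK Hphi Hpsi K2).
- exact: (pullbackK Hpsi Hphi K1).
- exact: top_coef_eq0.
Qed.
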